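(* Let $M$ be a finite-dimensional Riemannian manifold, $\Omega\subset M$ open, $T>0$, and $F\in C(\chi,\mathbb{R})$. Let $u$ be a (viscosity) solution of $u_t+F\le0$ in $(0,T)\times\Omega$. Suppose $u_*$ fails to be a supersolution at some point $(\hat t,\hat x)\in(0,T)\times\Omega$, i.e. there exists $(p,\zeta,A)\in\mathcal{P}^{2,-}u_*(\hat t,\hat x)$ for which $p+F(\hat t,\hat x,u_*(\hat t,\hat x),\zeta,A)<0$. Then for any small $\kappa>0$ there is a (viscosity) subsolution $u_\kappa$ of $u_t+F\le0$ in $(0,T)\times\Omega$ satisfying $$\begin{cases}u_\kappa(t,x)\ge u(t,x)\quad\text{and}\quad\sup_{(0,T)\times\Omega}(u_\kappa-u)>0,\\ u_\kappa(t,x)=u(t,x)\ \text{ for }(t,x)\in(0,T)\times\Omega\text{ with }|t-\hat t|+d(x,\hat x)\ge\kappa.\end{cases}$$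
   Context: Notation. $TM_x$, $TM_x^*$ are the tangent and cotangent spaces at $x$; $\mathcal{L}^2_s(TM_x)$ is the space of symmetric bilinear forms on $TM_x$; $d(\cdot,\cdot)$ is the Riemannian distance; $d\varphi$, $d^2\varphi$ denote the first derivative and Hessian in the space variable $x$. $$\chi=\{(t,x,r,\zeta,A): t\in[0,T],\ x\in M,\ r\in\mathbb{R},\ \zeta\in TM_x^*,\ A\in\mathcal{L}^2_s(TM_x)\}.$$ $F$ is evaluated along a function $u$ as $F(t,x,u,du,d^2u)$. Lower semicontinuous envelope. $u_*(t,x)=\lim_{r\downarrow0}\inf\{u(s,y):(s,y)\in(0,T)\times\Omega,\ |s-t|\le r,\ d(y,x)\le r\}$. Parabolic jets. For $f$ upper semicontinuous, $\mathcal{P}^{2,+}f(t,x)$ is the set of triples $(\varphi_t(t,x),d\varphi(t,x),d^2\varphi(t,x))$ where $\varphi\in C^{1,2}([0,T]\times M)$ and $f-\varphi$ attains a local maximum equal to $0$ at $(t,x)$. For $f$ lower semicontinuous, $\mathcal{P}^{2,-}f(t,x)$ is defined in the same way with local minimum equal to $0$. Solution of $u_t+F\le0$. A real-valued upper semicontinuous function $u$ on $(0,T)\times\Omega$ is a solution (equivalently, subsolution) of $u_t+F\le0$ in $(0,T)\times\Omega$ if $p+F(t,x,u(t,x),\zeta,A)\le0$ for all $(t,x)\in(0,T)\times\Omega$ and all $(p,\zeta,A)\in\mathcal{P}^{2,+}u(t,x)$.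
   Formalization: F is additionally assumed degenerate elliptic (nonincreasing in A); without this the claim is false, e.g. M = ℝ, F = min(A,0) + max(r,0), u = 0. *)

(* Defs.v *)
From HB Require Import structures.
From mathcomp Require Import all_boot all_order all_algebra.
From mathcomp Require Import all_classical all_reals all_analysis.
Set Implicit Arguments.
Unset Strict Implicit.
Unset Printing Implicit Defensive.
Import Order.TTheory GRing.Theory Num.Theory.
Import numFieldNormedType.Exports.
Local Open Scope classical_set_scope.
Local Open Scope ring_scope.

Section Calculus.
Context {R : realType}.

(* Derivative relative to a set D of reals: for D = [a, b] this is the
   one-sided derivative at the end points. *)
Definition derivable_in {V : normedModType R} (D : set R) (f : R -> V) (t : R) :=
  cvg ((s - t)^-1 *: (f s - f t) @[s --> within D t^']).

Definition derive_in {V : normedModType R} (D : set R) (f : R -> V) (t : R) : V :=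
  lim ((s - t)^-1 *: (f s - f t) @[s --> within D t^']).

Definition partial {n} {V : normedModType R} (i : 'I_n) (f : 'rV[R]_n -> V) :
    'rV[R]_n -> V :=
  fun y => 'D_(delta_mx 0 i) f y.

(* C^oo on an open set U: all iterated partial derivatives are differentiable. *)
Definition smooth_on {n} {V : normedModType R} (U : set 'rV[R]_n)
    (f : 'rV[R]_n -> V) :=
  forall (s : seq 'I_n) (y : 'rV[R]_n), U y ->
    differentiable (foldr (fun i g => partial i g) f s) y.

End Calculus.

Record chart (R : realType) (n : nat) (X : topologicalType) := Chart {
  cdom : set X ;
  cfun : X -> 'rV[R]_n ;
  cinv : 'rV[R]_n -> X ;
  cdom_open : open cdom ;
  cimg_open : open (cfun @` cdom) ;
  cfunK : forall x, cdom x -> cinv (cfun x) = x ;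
  cfun_continuous : {within cdom, continuous cfun} ;
  cinv_continuous : {within cfun @` cdom, continuous cinv}
}.

Definition cimg (R : realType) (n : nat) (X : topologicalType)
  (c : chart R n X) : set 'rV[R]_n := cfun c @` cdom c.

(* [chart_at x] is a preferred chart around x; it serves to represent the fibre
   at x of each tensor bundle (see below). *)
Record manifold (R : realType) (n : nat) := Manifold {
  msort :> topologicalType ;
  m_hausdorff : hausdorff_space msort ;
  m_second_countable : @second_countable msort ;
  atlas : set (chart R n msort) ;
  chart_at : msort -> chart R n msort ;
  chart_at_atlas : forall x, atlas (chart_at x) ;
  chart_at_dom : forall x, cdom (chart_at x) x ;
  atlas_smooth : forall a b, atlas a -> atlas b ->
    smooth_on (cfun a @` (cdom a `&` cdom b)) (cfun b \o cinv a)
}.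

(* The tangent space at x is 'rV_n, a tangent vector being represented by its
   components in the chart [chart_at x]. Accordingly a covector zeta at x is a
   column 'cV_n, acting by v |-> v *m zeta, and a bilinear form A at x is a
   matrix 'M_n, acting by (v, w) |-> v *m A *m w^T.
   The components of v, zeta, A in two charts a, b around x are related by
     v_b = v_a *m P,  zeta_a = P *m zeta_b,  A_a = P *m A_b *m P^T
   where P = transition a b x. *)
Definition transition (R : realType) (n : nat) (M : manifold R n)
    (a b : chart R n M) (x : M) : 'M[R]_n :=
  'J (cfun b \o cinv a) (cfun a x).

Definition form_in_chart (R : realType) (n : nat) (M : manifold R n)
    (g : M -> 'M[R]_n) (c : chart R n M) (y : 'rV[R]_n) : 'M[R]_n :=
  let x := cinv c y in
  let P := transition c (chart_at x) x in P *m g x *m P^T.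

Record riemannian (R : realType) (n : nat) := Riemannian {
  rsort :> manifold R n ;
  metric : rsort -> 'M[R]_n ;
  metric_sym : forall x, (metric x)^T = metric x ;
  metric_pos : forall x (v : 'rV[R]_n), v != 0 ->
    0 < (v *m metric x *m v^T) 0 0 ;
  metric_smooth : forall c, atlas c ->
    smooth_on (cimg c) (form_in_chart metric c)
}.

Section RiemannianManifold.
Context {R : realType} {n : nat} {M : riemannian R n}.

Definition gmx (c : chart R n M) : 'rV[R]_n -> 'M[R]_n :=
  form_in_chart (@metric R n M) c.

(* Gamma^k_ij of the Levi-Civita connection in the chart c *)
Definition christoffel (c : chart R n M) (k i j : 'I_n) (y : 'rV[R]_n) : R :=
  2^-1 * \sum_(l < n) invmx (gmx c y) k l *
    (partial i (fun z => gmx c z j l) y + partial j (fun z => gmx c z i l) y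
     - partial l (fun z => gmx c z i j) y).

Definition C1_curve_on (I : set R) (gamma : R -> M) :=
  {within I, continuous gamma} /\
  forall c : chart R n M, atlas c ->
    (forall s, I s -> cdom c (gamma s) -> derivable_in I (cfun c \o gamma) s) /\
    {within I `&` gamma @^-1` cdom c, continuous (derive_in I (cfun c \o gamma))}.

Definition piecewise_C1 (gamma : R -> M) :=
  exists s : seq R, [/\ path <%R 0 s, last 0 s = 1 &
    forall i, (i < size s)%N ->
      C1_curve_on `[nth 0 (0 :: s) i, nth 0 s i]%classic gamma].

(* At the finitely many break points the velocity may fail to exist; this does
   not affect the length. *)
Definition speed (gamma : R -> M) (s : R) : R :=
  let v := derive_in `[0, 1]%classic (cfun (chart_at (gamma s)) \o gamma) s in
  Num.sqrt ((v *m metric (gamma s) *m v^T) 0 0).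

Definition curve_length (gamma : R -> M) : \bar R :=
  (\int[lebesgue_measure]_(s in `[0%R, 1%R]) (speed gamma s)%:E)%E.

(* +oo between different connected components *)
Definition rdist (x y : M) : \bar R :=
  ereal_inf (curve_length @`
    [set gamma | [/\ piecewise_C1 gamma, gamma 0 = x & gamma 1 = y]]).

Section SpaceTime.
Variable T : R.

Definition tderiv (phi : R * M -> R) (z : R * M) : R :=
  derive_in `[0, T]%classic (fun s => phi (s, z.2)) z.1.

Definition in_chart (c : chart R n M) (phi : R * M -> R) (w : R * 'rV[R]_n) : R :=
  phi (w.1, cinv c w.2).

Definition xpartial (i : 'I_n) (f : R * 'rV[R]_n -> R) (w : R * 'rV[R]_n) : R :=
  partial i (fun y => f (w.1, y)) w.2.

Definition xderivable (i : 'I_n) (f : R * 'rV[R]_n -> R) (w : R * 'rV[R]_n) :=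
  derivable (fun y => f (w.1, y)) w.2 (delta_mx 0 i).

(* phi is of class C^{1,2} on [0, T] x M; its values elsewhere are irrelevant. *)
Definition C12 (phi : R * M -> R) :=
  [/\ {within `[0, T] `*` setT, continuous phi},
      forall z, (`[0, T] `*` setT) z ->
        derivable_in `[0, T]%classic (fun s => phi (s, z.2)) z.1,
      {within `[0, T] `*` setT, continuous (tderiv phi)} &
      forall c : chart R n M, atlas c -> forall i j : 'I_n,
        let f := in_chart c phi in let D := `[0, T] `*` cimg c in
        [/\ forall w, D w -> xderivable i f w,
            {within D, continuous (xpartial i f)},
            forall w, D w -> xderivable j (xpartial i f) w &
            {within D, continuous (xpartial j (xpartial i f))}]].

Definition xdiff (phi : R * M -> R) (z : R * M) : 'cV[R]_n :=
  let c := chart_at z.2 in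
  \col_i xpartial i (in_chart c phi) (z.1, cfun c z.2).

(* the Riemannian Hessian: the covariant derivative of the differential *)
Definition xhess (phi : R * M -> R) (z : R * M) : 'M[R]_n :=
  let c := chart_at z.2 in let f := in_chart c phi in
  let w := (z.1, cfun c z.2) in
  \matrix_(i, j) (xpartial j (xpartial i f) w
    - \sum_(k < n) christoffel c k i j w.2 * xpartial k f w).

Variable Omega : set M.

Definition cylinder : set (R * M) := `]0, T[ `*` Omega.

Definition superjet (f : R * M -> \bar R) (z : R * M) :
    set (R * 'cV[R]_n * 'M[R]_n) :=
  [set q | exists phi : R * M -> R, [/\ C12 phi,
    \forall w \near within cylinder (nbhs z), (f w - (phi w)%:E <= 0)%E,
    (f z - (phi z)%:E = 0)%E &
    q = (tderiv phi z, xdiff phi z, xhess phi z)]].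

Definition subjet (f : R * M -> \bar R) (z : R * M) :
    set (R * 'cV[R]_n * 'M[R]_n) :=
  [set q | exists phi : R * M -> R, [/\ C12 phi,
    \forall w \near within cylinder (nbhs z), (0 <= f w - (phi w)%:E)%E,
    (f z - (phi z)%:E = 0)%E &
    q = (tderiv phi z, xdiff phi z, xhess phi z)]].

Definition usc_on (D : set (R * M)) (u : R * M -> R) :=
  forall z, D z -> forall a : R, u z < a ->
    \forall w \near within D (nbhs z), u w < a.

(* u_*, with values in \bar R since u need not be locally bounded below *)
Definition lsc_env (u : R * M -> R) (z : R * M) : \bar R :=
  lim (ereal_inf [set (u w)%:E | w in
         [set w | [/\ cylinder w, `|w.1 - z.1| <= r & (rdist w.2 z.2 <= r%:E)%E]]]
       @[r --> 0^'+]).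

Definition is_subsolution (F : R -> M -> R -> 'cV[R]_n -> 'M[R]_n -> R)
    (u : R * M -> R) :=
  usc_on cylinder u /\
  forall z, cylinder z -> forall p zeta A,
    superjet (EFin \o u) z (p, zeta, A) -> p + F z.1 z.2 (u z) zeta A <= 0.

End SpaceTime.

(* F is continuous on chi: continuity in the bundle charts induced by the charts
   a of M. A point of chi is given as (t, x, r, zeta, A) with zeta, A the
   components in a. *)
Definition chi_continuous (T : R) (F : R -> M -> R -> 'cV[R]_n -> 'M[R]_n -> R) :=
  forall a : chart R n M, atlas a ->
  {within [set w : R * M * R * 'cV[R]_n * 'M[R]_n |
      let: (t, x, r, zeta, A) := w in
      [/\ 0 <= t <= T, cdom a x & A^T = A]],
    continuous (fun w : R * M * R * 'cV[R]_n * 'M[R]_n =>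
      let: (t, x, r, zeta, A) := w in
      let P := transition (chart_at x) a x in
      F t x r (P *m zeta) (P *m A *m P^T))}.

(* Degenerate ellipticity: F is nonincreasing in A. Without this standing
   assumption of viscosity theory the bump construction fails: on M = R,
   F = min(A, 0) + max(r, 0) and u = 0 is a subsolution that is not a
   supersolution, but it admits no larger subsolution with u_kappa = u outside
   a small compact set. *)
Definition degenerate_elliptic (T : R)
    (F : R -> M -> R -> 'cV[R]_n -> 'M[R]_n -> R) :=
  forall t (x : M) r (zeta : 'cV[R]_n) (A B : 'M[R]_n), 0 <= t <= T ->
    A^T = A -> B^T = B ->
    (forall v : 'rV[R]_n, (v *m A *m v^T) 0 0 <= (v *m B *m v^T) 0 0) ->
    F t x r zeta B <= F t x r zeta A.

End RiemannianManifold.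

(* Main.v *)
(** Let phi touch u_* from below at (that, xhat), where the supersolution
    inequality fails strictly. In a chart a around xhat put
    Q (t, x) = (t - that)^2 + |a x - a xhat|^2 and w = phi + gam (eta - Q).
    For small gam > 0 the components in a of the jet of w near (that, xhat) are
    close to those of phi, so by continuity of F in the bundle chart w is a
    strict classical subsolution there. Since w <= phi <= u_* <= u where
    Q >= eta, and since w > u at some points close to (that, xhat), because
    w = u_* + gam eta at (that, xhat), the function equal to max (u, w) on
    {Q <= eta} and to u elsewhere has the required properties.

    Two facts of Riemannian geometry enter. The distance induces the topology of
    M, so that {Q <= eta} is contained in the kappa-ball and u_*, which is
    defined by means of the distance, is approximated by values of u near
    (that, xhat) in the topology of M. The covariant Hessian is a tensor, so that
    jets, which are given in the chart [chart_at x], may be compared in a. *)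

Require Import Defs.
From HB Require Import structures.
From mathcomp Require Import all_boot all_order all_algebra.
From mathcomp Require Import all_classical all_reals all_analysis.
From mathcomp Require Import measurable_realfun.
From mathcomp Require Import ring lra.
Set Implicit Arguments.
Unset Strict Implicit.
Unset Printing Implicit Defensive.
Import Order.TTheory GRing.Theory Num.Theory.
Import numFieldNormedType.Exports.
Local Open Scope classical_set_scope.
Local Open Scope ring_scope.

(** Jets at [x] are given in [chart_at x], which may jump with [x], so their components need not
    vary continuously. Every jet is therefore carried to the single chart [a], where the partials of
    [phi], the Christoffel symbols and [F] are continuous.

    The bump is never differentiated as a function on [M]. It is compared with a test function [psi]
    touching it from above: the first order jets agree, hence the Christoffel corrections cancel and
    the Hessians are ordered, and degenerate ellipticity passes the strict inequality to [psi].

    The hard half of the topology statement is that a short curve cannot reach [x0] from far away: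
    on its way through a chart ball some coordinate must vary by the radius. The argument works on
    the final stretches, after the last exit from a ball, because earlier parts may leave the chart.

    Strictness holds jointly in the point and in [(gam, del)] near [(0, 0)]. So a radius [r] is
    fixed first, then [eta = r ^+ 2 / 2], and only then [gam], with [del = gam * eta]. The factor 2
    leaves a shell [eta < Q <= r ^+ 2] on which the bump lies below [u], so that the glued function
    is a maximum near every point of [Q <= eta], boundary included. *)

Section Limits.
Context {R : realType} {T : Type} {F : set_system T} {FF : Filter F}.

Lemma cvg_sumr (I : Type) (r : seq I) (f : I -> T -> R) (l : I -> R) :
  (forall i, f i x @[x --> F] --> l i) ->
  \sum_(i <- r) f i x @[x --> F] --> \sum_(i <- r) l i.
Proof.
move=> H; elim: r => [|i r IH].
  by under eq_fun do rewrite big_nil; rewrite big_nil; exact: cvg_cst.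
under eq_fun do rewrite big_cons; rewrite big_cons; exact: cvgD.
Qed.

Lemma cvg_prodr (I : Type) (r : seq I) (f : I -> T -> R) (l : I -> R) :
  (forall i, f i x @[x --> F] --> l i) ->
  \prod_(i <- r) f i x @[x --> F] --> \prod_(i <- r) l i.
Proof.
move=> H; elim: r => [|i r IH].
  by under eq_fun do rewrite big_nil; rewrite big_nil; exact: cvg_cst.
under eq_fun do rewrite big_cons; rewrite big_cons; exact: cvgM.
Qed.

Lemma cvg_mx m n (A : T -> 'M[R]_(m, n)) (L : 'M[R]_(m, n)) :
  (forall i j, A x i j @[x --> F] --> L i j) -> A x @[x --> F] --> L.
Proof.
move=> H; apply/cvgrPdist_le => e e0.
have : \forall x \near F, forall ij : 'I_m * 'I_n,
    `|L ij.1 ij.2 - A x ij.1 ij.2| <= e.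
  apply: (@filter_forall _ _ _ F) => -[i j] /=.
  exact: ((cvgrPdist_le _ _).1 (H i j)).
apply: filterS => x Hx; rewrite [leLHS]/Num.norm /= mx_normrE.
by apply: bigmax_le; [exact: ltW|move=> ij _; rewrite !mxE].
Qed.

Lemma cvg_mx_entry m n (A : T -> 'M[R]_(m, n)) (L : 'M[R]_(m, n)) i j :
  A x @[x --> F] --> L -> A x i j @[x --> F] --> L i j.
Proof.
move=> AL; apply: (@cvg_comp _ _ _ A (fun B : 'M[R]_(m, n) => B i j) F (nbhs L)) => //.
exact: coord_continuous.
Qed.

Lemma cvg_det n (A : T -> 'M[R]_n) (L : 'M[R]_n) :
  (forall i j, A x i j @[x --> F] --> L i j) -> \det (A x) @[x --> F] --> \det L.
Proof.
move=> H; apply: cvg_sumr => s.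
by apply: cvgM; [exact: cvg_cst|exact: cvg_prodr].
Qed.

(** For a singular matrix [invmx] returns the matrix itself, so the adjugate formula is available
    only once the determinants are eventually nonzero; its entries are then polynomials divided by
    the determinant. *)
Lemma cvg_invmx n (A : T -> 'M[R]_n) (L : 'M[R]_n) :
  L \in unitmx -> A x @[x --> F] --> L -> invmx (A x) @[x --> F] --> invmx L.
Proof.
move=> uL AL; have AL' i j := @cvg_mx_entry _ _ A L i j AL.
have dL : \det (A x) @[x --> F] --> \det L by exact: cvg_det.
have dL0 : \det L != 0 by rewrite -unitfE.
have near_unit : \forall x \near F, A x \in unitmx.
  have := @cvgr_neq0 _ _ _ _ FF _ _ dL dL0.
  by apply: filterS => x; rewrite unitmxE unitfE.
have key : (\det (A x))^-1 *: \adj (A x) @[x --> F] --> invmx L.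
  rewrite /invmx uL; apply: cvg_mx => i j; rewrite !mxE.
  under eq_fun do rewrite !mxE.
  apply: cvgM; first exact: cvgV.
  apply: cvgM; [exact: cvg_cst|]; apply: cvg_det => a b.
  rewrite (_ : (fun x => _) = fun x => A x (lift j a) (lift i b)).
    by rewrite !mxE.
  by apply/funext => x; rewrite !mxE.
apply: cvg_trans key; apply: near_eq_cvg.
by apply: filterS near_unit => x uA; rewrite /invmx uA.
Qed.

End Limits.

(** * Directional and partial derivatives *)

Lemma dist_common (K : realDomainType) (c p q a : K) :
  `|c - p| <= a -> `|c - q| <= a -> `|p - q| <= a + a.
Proof.
by move=> cp cq; rewrite (le_trans (ler_distD c _ _))// lerD// distrC.
Qed.

(** The shape in which two first order expansions around the same point are subtracted in
    [second_difference]. *)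
Lemma dist_affine (K : realFieldType) (a b c p q d : K) :
  `|c - (b + q)| <= d -> `|a - (b + (p + q))| <= d -> `|a - c - p| <= d + d.
Proof.
have -> : a - c - p = (a - (b + (p + q))) - (c - (b + q)) by ring.
by move=> cd ad; rewrite (le_trans (ler_normB _ _))// lerD.
Qed.

Section Directional.
Context {R : realType} {V W : normedModType R}.
Implicit Types (f : V -> W) (x v : V).

Lemma is_derive_line f x v (s : R) : derivable f (x + s *: v) v ->
  is_derive s 1 (fun r => f (x + r *: v)) ('D_v f (x + s *: v)).
Proof.
move=> df.
have E : (fun h => h^-1 *: (((fun r => f (x + r *: v)) \o shift s) (h *: 1) -
    f (x + s *: v))) =
    (fun h => h^-1 *: ((f \o shift (x + s *: v)) (h *: v) - f (x + s *: v))).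
  apply/funext => h /=; congr (_ *: (f _ - _)).
  by rewrite [h *: 1]mulr1 scalerDl addrCA.
by apply: DeriveDef; rewrite /derivable /derive E.
Qed.

Lemma is_derive_translate f x v (w : V) : derivable f (x + w) v ->
  is_derive x v (fun z => f (z + w)) ('D_v f (x + w)).
Proof.
move=> df.
have E : (fun h => h^-1 *: (((fun z => f (z + w)) \o shift x) (h *: v) -
    f (x + w))) =
    (fun h => h^-1 *: ((f \o shift (x + w)) (h *: v) - f (x + w))).
  by apply/funext => h /=; rewrite addrA.
by apply: DeriveDef; rewrite /derivable /derive E.
Qed.

Lemma differentiable_near f x (e : R) : differentiable f x -> 0 < e ->
  \forall z \near x, `|f z - (f x + 'd f x (z - x))| <= e * `|z - x|.
Proof.
move=> [[_ df]] e0.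
have /eqaddoP/(_ e e0) := df; by rewrite lim_id.
Qed.

(** Uniqueness of the differential identifies [L]. Candidates for a differential are checked below
    in this epsilon form, without handling little-o terms. *)
Lemma near_differentiable f x (L : {linear V -> W}) : continuous L ->
  (forall e : R, 0 < e ->
    \forall z \near x, `|f z - (f x + L (z - x))| <= e * `|z - x|) ->
  differentiable f x /\ 'd f x = L :> (V -> W).
Proof.
move=> cL H.
have key : f \o shift x = cst (f x) + L +o_ 0 id.
  apply/eqaddoP => e e0.
  have := H e e0; rewrite (near_shift 0) subr0; apply: filterS => h /=.
  by rewrite addrK.
have dE := diff_unique cL key.
by split=> //; apply/diff_locallyP; rewrite dE.
Qed.

Lemma near_eq_differentiable f g x : {near x, f =1 g} ->
  differentiable f x -> differentiable g x.
Proof.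
move=> fg df; apply: (proj1 (@near_differentiable _ x ('d f x) _ _)).
  exact: diff_continuous.
move=> e e0; have := differentiable_near df e0.
rewrite (nbhs_singleton fg).
by apply: filterS2 fg => z ->.
Qed.
End Directional.

Section MeanValue.
Context {R : realType} {V : normedModType R}.
Implicit Types (f : V -> R) (x v : V).

Lemma mean_value_line f x v (h : R) :
  (forall s : R, `|s| <= `|h| -> derivable f (x + s *: v) v) ->
  exists2 s : R, `|s| <= `|h| & f (x + h *: v) - f x = h * 'D_v f (x + s *: v).
Proof.
move=> df.
pose g r := f (x + r *: v).
have dg (s : R) : `|s| <= `|h| -> is_derive s 1 g ('D_v f (x + s *: v)).
  by move=> sh; apply: is_derive_line; exact: df.
have g0 : g 0 = f x by rewrite /g scale0r addr0.
rewrite -/(g h) -g0.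
have [h0|h0] := leP 0 h.
  have sub s : s \in `[0, h] -> `|s| <= `|h|.
    by rewrite in_itv /= => /andP[s0 sh]; rewrite !ger0_norm.
  have [||s sI ->] := @MVT_segment _ g (fun s => 'D_v f (x + s *: v)) _ _ h0.
  - move=> s sI; apply: dg; apply: sub.
    by move: sI; rewrite !in_itv /= => /andP[/ltW -> /ltW].
  - apply: derivable_within_continuous => s /sub /dg [].
    by [].
  - by exists s; rewrite ?sub// subr0 mulrC.
have sub s : s \in `[h, 0] -> `|s| <= `|h|.
  rewrite in_itv /= => /andP[s0 sh].
  by rewrite ler0_norm// ltr0_norm// lerN2.
have [||s sI E] := @MVT_segment _ g (fun s => 'D_v f (x + s *: v)) _ _ (ltW h0).
- move=> s sI; apply: dg; apply: sub.
  by move: sI; rewrite !in_itv /= => /andP[/ltW -> /ltW].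
- by apply: derivable_within_continuous => s /sub /dg [].
- exists s; rewrite ?sub// -opprB E; ring.
Qed.
End MeanValue.

Section RowVectors.
Context {R : realType} {n : nat}.
Implicit Types (f : 'rV[R]_n -> R) (y v : 'rV[R]_n) (i j : 'I_n).

Lemma entry_le_norm v i : `|v 0 i| <= `|v|.
Proof. by rewrite [leRHS]/Num.norm /= mx_normrE; exact: (le_bigmax _ _ (0, i)). Qed.

Lemma row_norm_le v (e : R) : 0 <= e -> (forall i, `|v 0 i| <= e) -> `|v| <= e.
Proof.
move=> e0 H; rewrite [leLHS]/Num.norm /= mx_normrE.
by apply: bigmax_le => // -[a b] _ /=; rewrite (ord1 a).
Qed.

Lemma sum_entry_le (F : 'I_n -> R) (e : R) :
  (forall i, `|F i| <= e) -> `|\sum_i F i| <= n%:R * e.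
Proof.
move=> H; apply: le_trans (ler_norm_sum _ _ _) _.
rewrite (le_trans (ler_sum _ (fun i _ => H i)))// sumr_const card_ord mulr_natl.
exact: lexx.
Qed.

(** The candidate differential in [C1_differentiable], declared linear so that [near_differentiable]
    applies to it. *)
Definition gradient_form (D : 'cV[R]_n) (v : 'rV[R]_n) : R := (v *m D) 0 0.

Lemma gradient_form_linear D : linear (gradient_form D).
Proof. by move=> a u v; rewrite /gradient_form mulmxDl -scalemxAl !mxE. Qed.

HB.instance Definition _ D := GRing.isLinear.Build R 'rV[R]_n R _
  (gradient_form D) (gradient_form_linear D).

Lemma gradient_formE D v : gradient_form D v = \sum_i v 0 i * D i 0.
Proof. by rewrite /gradient_form mxE. Qed.

Lemma gradient_form_continuous D : continuous (gradient_form D).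
Proof.
have -> : gradient_form D = fun v => \sum_i v 0 i * D i 0.
  by apply/funext => v; rewrite gradient_formE.
move=> v; apply: (@cvg_sumr R _ (nbhs v)) => i.
by apply: cvgM; [exact: coord_continuous|exact: cvg_cst].
Qed.

(** Corners of the path from 0 to [v] that runs along one coordinate axis at a time. *)
Definition truncate_row (v : 'rV[R]_n) (k : nat) : 'rV[R]_n :=
  \row_j (if (j < k)%N then v 0 j else 0).

Lemma truncate_rowS v i :
  truncate_row v i.+1 = truncate_row v i + v 0 i *: delta_mx 0 i.
Proof.
apply/rowP => j; rewrite !mxE eqxx /= ltnS leq_eqVlt.
have [->|ne] := eqVneq j i; first by rewrite ltnn eqxx /= mulr1 add0r.
by rewrite (_ : (j == i :> nat) = false) ?mulr0 ?addr0// ; apply/negbTE.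
Qed.

Lemma truncate_row0 v : truncate_row v 0 = 0.
Proof. by apply/rowP => j; rewrite !mxE. Qed.

Lemma truncate_rowT v : truncate_row v n = v.
Proof. by apply/rowP => j; rewrite !mxE ltn_ord. Qed.

(** Since the norm is the maximum of the entries, every leg of this path stays in the ball of radius
    [|v|]. *)
Lemma truncate_row_norm v i (s : R) : `|s| <= `|v 0 i| ->
  `|truncate_row v i + s *: delta_mx 0 i| <= `|v|.
Proof.
move=> sv; apply: row_norm_le => // j; rewrite !mxE eqxx /=.
have [->|ne] := eqVneq j i.
  by rewrite ltnn mulr1 add0r (le_trans sv)// entry_le_norm.
by rewrite mulr0 addr0; case: ifP => _; rewrite ?normr0// entry_le_norm.
Qed.

Lemma differentiable_partial f y i : differentiable f y ->
  partial i f y = 'd f y (delta_mx 0 i).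
Proof. by move=> df; rewrite /partial deriveE. Qed.

Lemma diff_row f y v : differentiable f y ->
  'd f y v = \sum_i v 0 i * partial i f y.
Proof.
move=> df; rewrite {1}(row_sum_delta v) linear_sum; apply: eq_bigr => i _.
by rewrite linearZ /= differentiable_partial.
Qed.

(* Telescoping over the coordinates reduces this to the one-dimensional mean
   value theorem. *)
Lemma C1_differentiable f y :
  (forall i, \forall z \near y, derivable f z (delta_mx 0 i)) ->
  (forall i, {for y, continuous (partial i f)}) ->
  differentiable f y.
Proof.
move=> df cf; pose D : 'cV[R]_n := \col_i partial i f y.
apply: (proj1 (@near_differentiable _ _ _ _ y (gradient_form D) _ _)).
  exact: gradient_form_continuous.
(* The divisor is [n.+1] rather than [n] so that [e'] is positive in dimension zero as well. *)
move=> e e0; pose e' := e / n.+1%:R.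
have e'0 : 0 < e' by rewrite divr_gt0.
have H : \forall z \near y, forall i, derivable f z (delta_mx 0 i) /\
    `|partial i f y - partial i f z| < e'.
  apply: (@filter_forall _ _ _ (nbhs y)) => i; apply: filterI; first exact: df.
  by have /cvgrPdist_lt/(_ e' e'0) := cf i.
case/nbhs_ballP: H => r /= r0 H.
apply/nbhs_ballP; exists r => //= z; rewrite -ball_normE /= => yz.
pose v := z - y; have nv : `|v| < r by rewrite distrC.
have inball w : `|w| <= `|v| -> ball y r (y + w).
  move=> wv; rewrite -ball_normE /= opprD addrA subrr sub0r normrN.
  exact: le_lt_trans nv.
have zE : z = y + truncate_row v n by rewrite truncate_rowT /v addrC subrK.
have tel : f z - f y = \sum_(i < n)
    (f (y + truncate_row v i.+1) - f (y + truncate_row v i)).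
  have -> : f y = f (y + truncate_row v 0) by rewrite truncate_row0 addr0.
  rewrite {1}zE -(big_mkord xpredT (fun i : nat => f (y + truncate_row v i.+1) - f (y + truncate_row v i))).
  by rewrite telescope_sumr.
rewrite opprD addrA tel -/v gradient_formE -sumrB.
have e'e : e * `|v| = n.+1%:R * (e' * `|v|).
  by rewrite /e' mulrA (mulrC n.+1%:R) divfK// pnatr_eq0.
rewrite e'e; apply: (@le_trans _ _ (n%:R * (e' * `|v|))); last first.
  by rewrite ler_wpM2r ?ler_nat// mulr_ge0// ltW.
apply: sum_entry_le => i.
have [|s sv E] := @mean_value_line _ _ f (y + truncate_row v i) (delta_mx 0 i) (v 0 i).
  move=> s sv; rewrite -addrA.
  by have [] := H _ (inball _ (truncate_row_norm sv)) i.
rewrite -addrA -truncate_rowS -addrA in E; rewrite E [D i 0]mxE -mulrBr normrM mulrC.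
apply: ler_pM => //; last exact: entry_le_norm.
rewrite distrC; apply: ltW.
by have [] := H _ (inball _ (truncate_row_norm sv)) i.
Qed.

End RowVectors.

(** * Second order derivatives *)

Section SecondOrder.
Context {R : realType}.

(** Second order differentiability at one point in the sense of Fréchet. It is weaker than C^2 but
    suffices for the symmetry of second partials, the chain rule and the second order test at a
    minimum. *)
Definition diff2 n (f : 'rV[R]_n -> R) (y : 'rV[R]_n) :=
  (\forall z \near y, differentiable f z) /\
  forall i, differentiable (partial i f) y.

Section OneFunction.
Context {n : nat}.
Implicit Types (f : 'rV[R]_n -> R) (y v : 'rV[R]_n) (i j : 'I_n).

Lemma near_eq_partial f g y i : {near y, f =1 g} ->
  {near y, partial i f =1 partial i g}.
Proof.
move=> /near_join fg; near=> z; apply: near_eq_derive.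
by near: z.
Unshelve. all: by end_near. Qed.

Lemma partialD f g y i : differentiable f y -> differentiable g y ->
  partial i (f + g) y = partial i f y + partial i g y.
Proof. by move=> df dg; rewrite /partial deriveD//; exact: diff_derivable. Qed.

Lemma partialN f y i : differentiable f y -> partial i (- f) y = - partial i f y.
Proof. by move=> df; rewrite /partial deriveN//; exact: diff_derivable. Qed.

Lemma partialM f g y i : differentiable f y -> differentiable g y ->
  partial i (f * g) y = f y * partial i g y + g y * partial i f y.
Proof. by move=> df dg; rewrite /partial deriveM//; exact: diff_derivable. Qed.

Lemma partial_sum m (f : 'I_m -> 'rV[R]_n -> R) y i :
  (forall k, differentiable (f k) y) ->
  partial i (\sum_k f k) y = \sum_k partial i (f k) y.
Proof. by move=> df; rewrite /partial derive_sum// => k; exact: diff_derivable. Qed.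

Lemma near_partialD f g y i :
  (\forall z \near y, differentiable f z) ->
  (\forall z \near y, differentiable g z) ->
  {near y, partial i f + partial i g =1 partial i (f + g)}.
Proof. by apply: filterS2 => z df dg; rewrite partialD. Qed.

Lemma diff2D f g y : diff2 f y -> diff2 g y -> diff2 (f + g) y.
Proof.
move=> [df ddf] [dg ddg]; split.
  by apply: filterS2 df dg => z; exact: differentiableD.
move=> i; apply: near_eq_differentiable (differentiableD (ddf i) (ddg i)).
exact: near_partialD.
Qed.

Lemma partial2D f g y i j : diff2 f y -> diff2 g y ->
  partial j (partial i (f + g)) y =
  partial j (partial i f) y + partial j (partial i g) y.
Proof.
move=> [df ddf] [dg ddg]; rewrite -partialD//.
by apply/esym/near_eq_derive; exact: near_partialD.
Qed.

Lemma diff2N f y : diff2 f y -> diff2 (- f) y.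
Proof.
move=> [df ddf]; split; first by apply: filterS df => z; exact: differentiableN.
move=> i; apply: near_eq_differentiable (differentiableN (ddf i)).
by apply: filterS df => z dfz; rewrite partialN.
Qed.

Lemma partial2N f y i j : diff2 f y ->
  partial j (partial i (- f)) y = - partial j (partial i f) y.
Proof.
move=> [df ddf]; rewrite -partialN//.
by apply: near_eq_derive; apply: filterS df => z dfz; rewrite partialN.
Qed.

Lemma partialZ (k : R) f y i : differentiable f y ->
  partial i (k *: f) y = k * partial i f y.
Proof. by move=> df; rewrite /partial deriveZ//; exact: diff_derivable. Qed.

Lemma diff2Z (k : R) f y : diff2 f y -> diff2 (k *: f) y.
Proof.
move=> [df ddf]; split; first by apply: filterS df => z; exact: differentiableZ.
move=> i; apply: near_eq_differentiable (differentiableZ k (ddf i)).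
by apply: filterS df => z dfz; rewrite partialZ.
Qed.

Lemma partial2Z (k : R) f y i j : diff2 f y ->
  partial j (partial i (k *: f)) y = k * partial j (partial i f) y.
Proof.
move=> [df ddf]; rewrite -partialZ//.
by apply: near_eq_derive; apply: filterS df => z dfz; rewrite partialZ.
Qed.

Lemma norm_delta_mx i : `|delta_mx 0 i : 'rV[R]_n| <= 1.
Proof.
apply: row_norm_le => // j; rewrite mxE eqxx /=.
by case: (_ == _); rewrite ?normr1 ?normr0.
Qed.

(* The second difference is symmetric in i and j, whence [partialC]. *)
Lemma second_difference f y i j (e : R) : diff2 f y -> 0 < e ->
  \forall h \near 0^'+,
  `|f (y + h *: delta_mx 0 j + h *: delta_mx 0 i) - f (y + h *: delta_mx 0 j) -
    f (y + h *: delta_mx 0 i) + f y - h ^+ 2 * partial j (partial i f) y|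
  <= e * h ^+ 2.
Proof.
move=> [df ddf] e0.
(* Two expansions are used at distance at most [2 h] from [y]; each costs [e / 4 * 2 h], together
   [e * h]. *)
have e30 : 0 < e / 4 by rewrite divr_gt0.
have H : nbhs y (fun z => differentiable f z /\ `|partial i f z -
    (partial i f y + 'd (partial i f) y (z - y))| <= e / 4 * `|z - y|).
  by apply: filterI => //; exact: (differentiable_near (ddf i)).
case/nbhs_ballP: H => r /= r0 H.
near=> h.
have h0 : 0 < h by near: h; exact: nbhs_right_gt.
have hr : h *+ 2 < r.
  rewrite -mulr_natr -ltr_pdivlMr//.
  by near: h; apply: nbhs_right_lt; rewrite divr_gt0.
have inb w : `|w| <= h *+ 2 -> ball y r (y + w).
  move=> wh; rewrite -ball_normE /= opprD addrA subrr sub0r normrN.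
  exact: le_lt_trans hr.
have nd (s : R) k : `|s| <= h -> `|s *: delta_mx 0 k : 'rV[R]_n| <= h.
  move=> sh; rewrite normrZ -[leRHS]mulr1.
  by rewrite ler_pM// norm_delta_mx.
have nd2 (s : R) : `|s| <= h ->
    `|h *: delta_mx 0 j + s *: delta_mx 0 i : 'rV[R]_n| <= h *+ 2.
  by move=> sh; rewrite (le_trans (ler_normD _ _))// mulr2n lerD// nd// gtr0_norm.
have nd1 (s : R) : `|s| <= h -> `|s *: delta_mx 0 i : 'rV[R]_n| <= h *+ 2.
  by move=> sh; rewrite (le_trans (nd _ _ sh))// mulr2n lerDl ltW.
(* One mean value, in direction [i], is applied to the increment in direction [j]. The resulting
   increment of [partial i f] is expanded at [y], so no second derivative at any other point is
   involved. *)
pose g z := f (z + h *: delta_mx 0 j) - f z.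
have dg (s : R) : `|s| <= `|h| -> is_derive (y + s *: delta_mx 0 i) (delta_mx 0 i) g
    (partial i f (y + (h *: delta_mx 0 j + s *: delta_mx 0 i)) -
     partial i f (y + s *: delta_mx 0 i)).
  rewrite (gtr0_norm h0) => sh.
  have d1 : differentiable f (y + s *: delta_mx 0 i) by apply: (H _ (inb _ (nd1 _ sh))).1.
  have d2 : differentiable f (y + (h *: delta_mx 0 j + s *: delta_mx 0 i)).
    by apply: (H _ (inb _ (nd2 _ sh))).1.
  apply: is_deriveB; last by apply: DeriveDef => //; exact: diff_derivable.
  have E : y + (h *: delta_mx 0 j + s *: delta_mx 0 i) =
           y + s *: delta_mx 0 i + h *: delta_mx 0 j by rewrite addrCA addrC.
  rewrite E in d2 *.
  exact: is_derive_translate (diff_derivable d2).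
have [|s sh E] := @mean_value_line _ _ g y (delta_mx 0 i) h.
  by move=> s /dg [].
rewrite (gtr0_norm h0) in sh.
have [_ dgE] := dg s ltac:(by rewrite (gtr0_norm h0)).
rewrite dgE /g in E => {dg dgE}.
have -> : f (y + h *: delta_mx 0 j + h *: delta_mx 0 i) - f (y + h *: delta_mx 0 j) -
    f (y + h *: delta_mx 0 i) + f y =
    h * (partial i f (y + (h *: delta_mx 0 j + s *: delta_mx 0 i)) -
     partial i f (y + s *: delta_mx 0 i)).
  rewrite -E (addrAC y (h *: delta_mx 0 j)); lra.
rewrite expr2 -mulrA -mulrBr normrM (gtr0_norm h0) (mulrA e) (mulrC e) -mulrA.
rewrite ler_pM2l//.
have := (H _ (inb _ (nd2 _ sh))).2; have := (H _ (inb _ (nd1 _ sh))).2.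
have K w : y + w - y = w by rewrite addrAC subrr add0r.
have lin1 : 'd (partial i f) y (s *: delta_mx 0 i) = s * partial i (partial i f) y.
  by rewrite linearZ /= -differentiable_partial.
have lin2 : 'd (partial i f) y (h *: delta_mx 0 j + s *: delta_mx 0 i) =
    h * partial j (partial i f) y + s * partial i (partial i f) y.
  by rewrite linearD !linearZ /= -!differentiable_partial.
rewrite !K lin1 lin2 => H1 H2.
have H3 := ler_wpM2l (ltW e30) (nd1 _ sh).
have H4 := ler_wpM2l (ltW e30) (nd2 _ sh).
move: (le_trans H1 H3) (le_trans H2 H4) => {}H1 {}H2.
rewrite (le_trans (dist_affine H1 H2))//.
by rewrite [e * h](_ : _ = e / 4 * (h *+ 2) + e / 4 * (h *+ 2))//; field.
Unshelve. all: by end_near. Qed.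

Lemma partialC f y i j : diff2 f y ->
  partial j (partial i f) y = partial i (partial j f) y.
Proof.
move=> d2; apply/eqP; rewrite -subr_eq0 -normr_le0; apply/ler_addgt0Pr => e e0.
rewrite add0r.
have e20 : 0 < e / 2 by rewrite divr_gt0.
have /(_ _ _)/filter_ex[h [h0 [H1 H2]]] := filterI (nbhs_right_gt (0 : R))
  (filterI (second_difference i j d2 e20) (second_difference j i d2 e20)).
have h20 : 0 < h ^+ 2 by rewrite exprn_gt0.
rewrite -(ler_pM2l h20) -{1}(gtr0_norm h20) -normrM mulrBr.
rewrite (addrAC y) (addrAC (f _)) in H2.
apply: le_trans (dist_common H1 H2) _.
by rewrite -mulrDl -splitr mulrC.
Qed.

Lemma near_line y v (P : set 'rV[R]_n) : nbhs y P ->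
  \forall s \near (0 : R), P (y + s *: v).
Proof.
move=> Py; have : y + s *: v @[s --> (0 : R)] --> y.
  rewrite -[X in _ --> X](addr0 y) -(scale0r v).
  by apply: cvgD; [exact: cvg_cst|apply: cvgZr_tmp; exact: cvg_id].
by apply.
Qed.

Lemma local_min_derive f y v : diff2 f y ->
  (\forall z \near y, f y <= f z) -> 'D_v f y = 0.
Proof.
move=> [df _] fm.
have fm' : \forall z \near y, differentiable f z /\ f y <= f z by apply: filterI.
have /nbhs_ballP[r /= r0 H] := near_line v fm'.
have E : y + 0 *: v = y by rewrite scale0r addr0.
have sub (t : R) : t \in `]-r, r[%R -> ball 0 r t.
  by rewrite in_itv /= -ltr_norml -ball_normE /= sub0r normrN.
have r0' : - r <= r by rewrite (le_trans _ (ltW r0))// oppr_le0 ltW.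
have [||t tr|d0 dE] := @derive1_at_min _ (fun s => f (y + s *: v)) _ _ 0 r0'.
- move=> t /sub/H[dft _].
  by apply: (ex_derive (is_derive := is_derive_line (diff_derivable dft))).
- by rewrite in_itv /= oppr_lt0 r0.
- by rewrite E; have [] := H _ (sub _ tr).
have [_] := H _ (ballxx 0 r0); rewrite E => _.
have [dy _] := H _ (ballxx 0 r0).
have := is_derive_line (diff_derivable dy) (v := v).
by case=> _; rewrite dE E => ->.
Qed.

(** If the sum [L] were negative, the derivative [G] of [f] along [v], which vanishes at [y] and has
    slope [L] there, would be negative just after [y]. By the mean value theorem [f] would then fall
    below its minimum. *)
Lemma local_min_partial2 f y v : diff2 f y ->
  (\forall z \near y, f y <= f z) ->
  0 <= \sum_i \sum_j v 0 i * v 0 j * partial j (partial i f) y.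
Proof.
move=> d2 fm; have [df ddf] := d2; set L := (\sum_i _).
rewrite leNgt; apply/negP => L0.
pose G := \sum_i (v 0 i *: partial i f : 'rV[R]_n -> R).
have GE z : differentiable f z -> 'D_v f z = G z.
  move=> dfz; rewrite deriveE// diff_row// /G fct_sumE.
  by apply: eq_bigr.
have dG : differentiable G y.
  by apply: differentiable_sum => i; exact: differentiableZ.
have GL : 'd G y v = L.
  rewrite diff_row// /L exchange_big /=; apply: eq_bigr => j _.
  rewrite {1}/G partial_sum; last by move=> i; exact: differentiableZ.
  rewrite mulr_sumr; apply: eq_bigr => i _.
  rewrite [X in _ * X]/partial deriveZ; last exact: diff_derivable (ddf i).
  by rewrite -/(partial j (partial i f) y) mulrA (mulrC (v 0 j)).
have Gy : G y = 0.
  by rewrite -GE ?local_min_derive//; exact: nbhs_singleton df.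
(* Makes the error [e * (s * |v|)] at most half of [s * - L]; the summand 1 covers [v = 0]. *)
pose e := - L / 2 / (`|v| + 1).
have v1 : 0 < `|v| + 1 by rewrite ltr_wpDl.
have e0 : 0 < e by rewrite !divr_gt0 ?oppr_gt0.
have fm' : \forall z \near y, differentiable f z /\ f y <= f z /\
    `|G z - (G y + 'd G y (z - y))| <= e * `|z - y|.
  by apply: filterI => //; apply: filterI => //; exact: (differentiable_near dG).
have /nbhs_ballP[r /= r0 H] := near_line v fm'.
have Gneg (s : R) : 0 < s -> s < r -> G (y + s *: v) < 0.
  move=> s0 sr; have [|_ [_]] := H s.
    by rewrite -ball_normE /= sub0r normrN gtr0_norm.
  rewrite Gy add0r addrAC subrr add0r linearZ /= GL normrZ (gtr0_norm s0).
  move=> /(le_trans (ler_norm _)) H1.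
  have H2 : e * (s * `|v|) <= s * (- L / 2).
    rewrite mulrCA ler_pM2l// /e mulrAC ler_pdivrMr// ler_pM2l ?lerDl//.
    by rewrite divr_gt0 ?oppr_gt0.
  have H3 : s * L < 0 by rewrite pmulr_rlt0.
  move: H1 H2 H3; rewrite /GRing.scale /=.
  move: (G _) (e * _) => a b; rewrite mulrA mulrN; move: (s * L) => c; lra.
pose s := r / 2.
have s0 : 0 < s by rewrite divr_gt0.
have sr : s < r by rewrite ltr_pdivrMr// ltr_pMr// ltr1n.
have inb (t : R) : 0 <= t -> t <= s -> ball 0 r t.
  by move=> t0 ts; rewrite -ball_normE /= sub0r normrN ger0_norm// (le_lt_trans ts).
have dl (t : R) : 0 <= t -> t <= s ->
    is_derive t 1 (fun s => f (y + s *: v)) ('D_v f (y + t *: v)).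
  move=> t0 ts; have [dt _] := H _ (inb _ t0 ts).
  exact: is_derive_line (diff_derivable dt).
have [||t] := @MVT _ (fun s => f (y + s *: v)) (fun t => 'D_v f (y + t *: v)) _ _ s0.
- by move=> t; rewrite in_itv /= => /andP[/ltW ? /ltW ?]; exact: dl.
- apply: derivable_within_continuous => t; rewrite in_itv /= => /andP[t0 ts].
  by have [] := dl t t0 ts.
rewrite in_itv /= => /andP[t0 ts]; rewrite scale0r addr0 subr0.
have [dt _] := H _ (inb _ (ltW t0) (ltW ts)); have [_ [fy _]] := H _ (inb _ (ltW s0) (lexx s)).
rewrite GE// => E; have := Gneg _ t0 (lt_trans ts sr).
by rewrite -(pmulr_llt0 _ s0) -E subr_lt0 ltNge fy.
Qed.

End OneFunction.
End SecondOrder.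

Section ChainRule.
Context {R : realType} {m n : nat}.
Implicit Types (t : 'rV[R]_m -> 'rV[R]_n) (f : 'rV[R]_n -> R) (y : 'rV[R]_m).

Definition coord t (k : 'I_n) (y : 'rV[R]_m) : R := t y 0 k.

Lemma differentiable_coords t y :
  (forall k, differentiable (coord t k) y) -> differentiable t y.
Proof.
move=> dt.
pose L v : 'rV[R]_n := \row_k 'd (coord t k) y v.
have linL : linear L by move=> a u v; apply/rowP => k; rewrite !mxE linearP.
pose LL := HB.pack_for {linear 'rV[R]_m -> 'rV[R]_n} L
  (GRing.isLinear.Build R _ _ _ L linL).
apply: (proj1 (@near_differentiable _ _ _ t y LL _ _)).
  move=> v; apply: (@cvg_mx R _ (nbhs v)) => i k; rewrite (ord1 i).
  under eq_fun do rewrite mxE; rewrite mxE.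
  exact: (diff_continuous (dt k)).
move=> e e0.
have H : \forall z \near y, forall k : 'I_n,
    `|coord t k z - (coord t k y + 'd (coord t k) y (z - y))| <= e * `|z - y|.
  apply: (@filter_forall _ _ _ (nbhs y)) => k.
  exact: (differentiable_near (dt k)).
apply: filterS H => z H; apply: row_norm_le => [|k]; first by rewrite mulr_ge0// ltW.
by rewrite !mxE; exact: H.
Qed.

Lemma differentiable_coordP t y k : differentiable t y -> differentiable (coord t k) y.
Proof.
move=> dt; apply: (@differentiable_comp _ _ _ _ t (fun v => v 0 k)) => //.
exact: (differentiable_coord _ 0 k).
Qed.

Lemma partial_coord t y i k : differentiable t y ->
  partial i (coord t k) y = partial i t y 0 k.
Proof.
move=> dt; rewrite [in RHS]/partial derive_mx; last exact: diff_derivable.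
by rewrite mxE.
Qed.

Lemma jacobian_partial t y i k : differentiable t y ->
  ('J t y) i k = partial i (coord t k) y.
Proof.
move=> dt; rewrite partial_coord// /partial deriveEjacobian//.
by rewrite -rowE [RHS]mxE.
Qed.

Lemma partial_comp f t y i :
  (forall k, differentiable (coord t k) y) -> differentiable f (t y) ->
  partial i (f \o t) y = \sum_k partial i (coord t k) y * partial k f (t y).
Proof.
move=> dt df; have dt' := differentiable_coords dt.
rewrite (differentiable_partial _ (differentiable_comp dt' df)) diff_comp//=.
rewrite diff_row//; apply: eq_bigr => k _; congr (_ * _).
by rewrite -(deriveE _ dt') partial_coord.
Qed.

Lemma near_diff_continuous t y : (forall k, diff2 (coord t k) y) -> {for y, continuous t}.
Proof.
move=> dt; apply: differentiable_continuous; apply: differentiable_coords => k.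
exact: nbhs_singleton (dt k).1.
Qed.

Lemma near_partial_comp f t y i :
  (forall k, diff2 (coord t k) y) -> diff2 f (t y) ->
  {near y, partial i (f \o t) =1
    fun z => \sum_k partial i (coord t k) z * partial k f (t z)}.
Proof.
move=> dt [df _].
have H1 : \forall z \near y, forall k, differentiable (coord t k) z.
  by apply: (@filter_forall _ _ _ (nbhs y)) => k; exact: (dt k).1.
have H2 : \forall z \near y, differentiable f (t z) := near_diff_continuous dt df.
by apply: filterS2 H1 H2 => z; exact: partial_comp.
Qed.

Lemma diff_partial2_comp f t y i :
  (forall k, diff2 (coord t k) y) -> diff2 f (t y) ->
  let g := fun z => \sum_k partial i (coord t k) z * partial k f (t z) in
  differentiable g y /\ forall j, partial j g y =
  \sum_k (partial j (partial i (coord t k)) y * partial k f (t y) +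
    partial i (coord t k) y *
    \sum_l partial j (coord t l) y * partial l (partial k f) (t y)).
Proof.
move=> dt [df ddf].
have dt1 k : differentiable (coord t k) y := nbhs_singleton (dt k).1.
have dtv := differentiable_coords dt1.
pose h k := (partial i (coord t k) : 'rV[R]_m -> R) * (partial k f \o t).
have dc k : differentiable (partial k f \o t) y.
  by apply: differentiable_comp => //; exact: ddf.
have dh k : differentiable (h k) y.
  by apply: differentiableM => //; exact: (dt k).2.
have gE : (fun z => \sum_k partial i (coord t k) z * partial k f (t z)) = \sum_k h k.
  by apply/funext => z; rewrite fct_sumE.
rewrite /= gE; split; first exact: differentiable_sum.
move=> j; rewrite partial_sum//; apply: eq_bigr => k _.
rewrite /h partialM//; last exact: (dt k).2.
by rewrite partial_comp// addrC [X in X + _]mulrC.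
Qed.

Lemma partial2_comp f t y i j :
  (forall k, diff2 (coord t k) y) -> diff2 f (t y) ->
  partial j (partial i (f \o t)) y =
  \sum_k (partial j (partial i (coord t k)) y * partial k f (t y) +
    partial i (coord t k) y *
    \sum_l partial j (coord t l) y * partial l (partial k f) (t y)).
Proof.
move=> dt df; rewrite -(diff_partial2_comp i dt df).2.
exact: near_eq_derive (near_partial_comp i dt df).
Qed.

End ChainRule.

(** * Tensoriality of the covariant Hessian *)

Section Christoffel.
Context {R : realType} {n : nat}.
Implicit Types (G : 'rV[R]_n -> 'M[R]_n) (f : 'rV[R]_n -> R) (y : 'rV[R]_n).

(* Twice the Christoffel symbols of the first kind. *)
Definition lowered_christoffel G (i j l : 'I_n) y : R :=
  partial i (fun z => G z j l) y + partial j (fun z => G z i l) y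
  - partial l (fun z => G z i j) y.

(** Convertible to [christoffel c] when [G] is [gmx c]. With an arbitrary matrix field, the
    transformation law becomes pure calculus on row vectors. *)
Definition christoffel_of G (k i j : 'I_n) y : R :=
  2^-1 * \sum_(l < n) invmx (G y) k l * lowered_christoffel G i j l y.

Definition covariant_hessian G f y : 'M[R]_n :=
  \matrix_(i, j) (partial j (partial i f) y
    - \sum_(k < n) christoffel_of G k i j y * partial k f y).

Definition gradient f y : 'cV[R]_n := \col_i partial i f y.

(** Brings the Christoffel correction into matrix form, where the inverse metric can be cancelled
    against the metric. *)
Lemma sum_christoffel G (D : 'cV[R]_n) i j y :
  \sum_k christoffel_of G k i j y * D k 0 =
  2^-1 * (D^T *m (invmx (G y) *m \col_l lowered_christoffel G i j l y)) 0 0.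
Proof.
rewrite mxE mulr_sumr; apply: eq_bigr => k _.
rewrite !mxE -mulrA (mulrC (D k 0)); congr (_ * (_ * _)).
by apply: eq_bigr => l _; rewrite mxE.
Qed.

Lemma lowered_christoffelC G i j l y : (forall z, (G z)^T = G z) ->
  lowered_christoffel G i j l y = lowered_christoffel G j i l y.
Proof.
move=> sG; rewrite /lowered_christoffel.
have E : (fun z => G z i j) = (fun z => G z j i).
  by apply/funext => z; rewrite -[in RHS]sG mxE.
by rewrite E [X in X - _]addrC.
Qed.

Lemma christoffel_ofC G k i j y : (forall z, (G z)^T = G z) ->
  christoffel_of G k i j y = christoffel_of G k j i y.
Proof.
move=> sG; congr (_ * _); apply: eq_bigr => l _.
by rewrite lowered_christoffelC.
Qed.

Lemma covariant_hessian_sym G f y : (forall z, (G z)^T = G z) -> diff2 f y ->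
  (covariant_hessian G f y)^T = covariant_hessian G f y.
Proof.
move=> sG df; apply/matrixP => i j; rewrite [LHS]mxE [LHS]mxE [RHS]mxE partialC//.
congr (_ + - _).
by apply: eq_bigr => k _; rewrite christoffel_ofC.
Qed.

Section Pullback.
Variables (t : 'rV[R]_n -> 'rV[R]_n) (G G' : 'rV[R]_n -> 'M[R]_n).
Variable y : 'rV[R]_n.
Hypothesis dt : forall k, diff2 (coord t k) y.
Hypothesis dG : forall a b, differentiable (fun z => G z a b) (t y).
Hypothesis sG : forall z, (G z)^T = G z.

(** [J] and [H] collect the first and second derivatives of [t]; [q] and [T] are the metric at [t y]
    and its derivative, read as multilinear forms. Cancellations then follow from symmetry instead
    of index bookkeeping. *)
Let J z : 'M[R]_n := \matrix_(i, k) partial i (coord t k) z.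
Let H i j k := partial j (partial i (coord t k)) y.
Let q (u v : 'I_n -> R) := \sum_a \sum_b u a * v b * G (t y) a b.
Let P a b c := partial c (fun z => G z a b) (t y).
Let T (u v w : 'I_n -> R) := \sum_a \sum_b \sum_c u a * v b * w c * P a b c.

Hypothesis pullback_metric : \forall z \near y, G' z = J z *m G (t z) *m (J z)^T.

Let HC i j k : H i j k = H j i k.
Proof. exact: partialC. Qed.

Let qC u v : q u v = q v u.
Proof.
rewrite /q exchange_big; apply: eq_bigr => a _; apply: eq_bigr => b _.
by rewrite -[in LHS]sG mxE (mulrC (u b)).
Qed.

Let PC a b c : P a b c = P b a c.
Proof.
rewrite /P; congr partial; apply/funext => z.
by rewrite -[in LHS]sG mxE.
Qed.

Let pullback_entry i j :
  {near y, \sum_a \sum_b (partial i (coord t a) * partial j (coord t b) *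
    ((fun z => G z a b) \o t)) =1 fun z => G' z i j}.
Proof.
apply: filterS pullback_metric => z ->.
rewrite fct_sumE mxE; under eq_bigr do rewrite fct_sumE.
rewrite exchange_big; apply: eq_bigr => b _.
rewrite !mxE mulr_suml; apply: eq_bigr => a _.
by rewrite !mxE mulrAC.
Qed.

(** Leibniz rule: the two [q] terms come from differentiating the Jacobian factors, the [T] term
    from differentiating [G] along [t]. *)
Let metric_partial i j l : partial l (fun z => G' z i j) y =
  q (H i l) (J y j) + q (J y i) (H j l) + T (J y i) (J y j) (J y l).
Proof.
have dt1 k : differentiable (coord t k) y := nbhs_singleton (dt k).1.
have dp i' k : differentiable (partial i' (coord t k)) y := (dt k).2 i'.
have dGt a b : differentiable ((fun z => G z a b) \o t) y.
  by apply: differentiable_comp => //; exact: differentiable_coords.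
have dpp i' j' a b : differentiable (partial i' (coord t a) * partial j' (coord t b) : _ -> R) y.
  exact: differentiableM.
have dall a b : differentiable (partial i (coord t a) * partial j (coord t b) *
    ((fun z => G z a b) \o t) : _ -> R) y by apply: differentiableM.
rewrite -[LHS](near_eq_derive (delta_mx 0 l) (pullback_entry i j)).
rewrite -[LHS]/(partial l _ y).
rewrite partial_sum; last by move=> a; exact: differentiable_sum.
rewrite /q /T -!big_split /=; apply: eq_bigr => a _.
rewrite partial_sum// -!big_split /=; apply: eq_bigr => b _.
rewrite partialM// partialM// partial_comp//= !mxE.
rewrite -/(H i l a) -/(H j l b) [LHS]addrC; congr (_ + _).
  have K (e u v w x : R) : e * (u * v + w * x) = x * w * e + u * v * e by ring.
  exact: K.
rewrite mulr_sumr; apply: eq_bigr => c _; rewrite !mxE -/(P a b c).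
by rewrite mulrA.
Qed.

(** The signed sum of three metric derivatives contains six [q] terms. By symmetry of [q] and [H],
    four cancel in pairs and two coincide, which leaves [2 * q (J y l) (H i j)]: the inhomogeneous
    term of the Christoffel transformation law. *)
Lemma lowered_christoffel_pullback i j :
  (\col_l lowered_christoffel G' i j l y) =
  J y *m ((\col_c \sum_a \sum_b J y i a * J y j b * lowered_christoffel G a b c (t y))
   + 2 *: (G (t y) *m \col_k H i j k)).
Proof.
apply/colP => l; rewrite mxE /lowered_christoffel !metric_partial.
rewrite mulmxDr !mxE.
have e1 : T (J y j) (J y l) (J y i) =
    \sum_a \sum_b \sum_k J y i a * J y j b * J y l k * P b k a.
  rewrite /T; under eq_bigr do rewrite exchange_big.
  rewrite exchange_big; do 3 (apply: eq_bigr => ? _); ring.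
have e2 : T (J y i) (J y l) (J y j) =
    \sum_a \sum_b \sum_k J y i a * J y j b * J y l k * P a k b.
  rewrite /T; under eq_bigr do rewrite exchange_big.
  do 3 (apply: eq_bigr => ? _); ring.
have -> : \sum_k J y l k * (\col_c \sum_a \sum_b J y i a * J y j b *
      lowered_christoffel G a b c (t y)) k 0 =
    T (J y j) (J y l) (J y i) + T (J y i) (J y l) (J y j) - T (J y i) (J y j) (J y l).
  rewrite e1 e2 /T -big_split -sumrB /=.
  under eq_bigr do rewrite mxE mulr_sumr.
  rewrite exchange_big; apply: eq_bigr => a _ /=.
  rewrite -big_split -sumrB /=.
  under eq_bigr do rewrite mulr_sumr.
  rewrite exchange_big; apply: eq_bigr => b _ /=.
  rewrite -big_split -sumrB /=; apply: eq_bigr => k _.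
  rewrite /lowered_christoffel -/(P b k a) -/(P a k b) -/(P a b k); ring.
have -> : \sum_k J y l k * (2 *: (G (t y) *m \col_k H i j k)) k 0 = 2 * q (J y l) (H i j).
  rewrite /q mulr_sumr; apply: eq_bigr => k _.
  rewrite !mxE mulrCA; congr (_ * _); rewrite mulr_sumr; apply: eq_bigr => a _.
  by rewrite mxE; ring.
have Hsym a b : H a b = H b a by apply/funext => k; exact: HC.
rewrite (Hsym j i) (Hsym l i) (Hsym l j).
have := qC (J y j) (H i l); have := qC (J y i) (H j l); have := qC (J y l) (H i j).
have K (a b c t1 t2 t3 : R) : a + b + t1 + (a + c + t2) - (b + c + t3) =
    t1 + t2 - t3 + 2 * a by ring.
by move=> -> _ ->; exact: K.
Qed.

Hypothesis uJ : J y \in unitmx.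
Hypothesis uG : G (t y) \in unitmx.

Lemma gradient_pullback f : diff2 f (t y) ->
  gradient (f \o t) y = J y *m gradient f (t y).
Proof.
move=> df; apply/colP => i; rewrite !mxE partial_comp//.
- by apply: eq_bigr => k _; rewrite !mxE.
- by move=> k; exact: nbhs_singleton (dt k).1.
- exact: nbhs_singleton df.1.
Qed.

(** The chain rule for second partials produces the second derivatives of [t] paired with the
    gradient of [f]. The inhomogeneous Christoffel term produces the same sum, and the two
    cancel. *)
Lemma covariant_hessian_pullback f : diff2 f (t y) ->
  covariant_hessian G' (f \o t) y = J y *m covariant_hessian G f (t y) *m (J y)^T.
Proof.
move=> df; apply/matrixP => i j; rewrite mxE.
have GE : G' y = J y *m G (t y) *m (J y)^T := nbhs_singleton pullback_metric.
have uG' : G' y \in unitmx by rewrite GE !unitmx_mul uJ uG unitmx_tr.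
(* The inverse metric transforms contravariantly, which absorbs the Jacobians on both of its
   sides. *)
have invE : (J y)^T *m invmx (G' y) *m J y = invmx (G (t y)).
  have uJT : (J y)^T \in unitmx by rewrite unitmx_tr.
  rewrite -[RHS]mul1mx -[LHS](mulmxK uG); congr (_ *m _).
  rewrite -[LHS](mulmxK uJT) -!mulmxA (mulmxA (J y)) (mulmxA _ (J y)^T) -GE.
  by rewrite (mulmxA (invmx _)) mulVmx// mul1mx mulmxV.
have -> : \sum_(k < n) christoffel_of G' k i j y * partial k (f \o t) y =
    \sum_a \sum_b J y i a * J y j b * (\sum_k christoffel_of G k a b (t y) *
      partial k f (t y)) + \sum_k H i j k * partial k f (t y).
  transitivity (\sum_k christoffel_of G' k i j y * (gradient (f \o t) y) k 0).
    by apply: eq_bigr => k _; rewrite [in RHS]mxE.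
  rewrite sum_christoffel lowered_christoffel_pullback gradient_pullback//.
  rewrite trmx_mul -!mulmxA (mulmxA (invmx (G' y))) (mulmxA (J y)^T) (mulmxA (J y)^T).
  rewrite invE mulmxDr mulmxDr mxE mulrDr; congr (_ + _).
    rewrite [X in invmx (G (t y)) *m X](_ : _ = \sum_a \sum_b
        (J y i a * J y j b) *: \col_l lowered_christoffel G a b l (t y)); last first.
      apply/colP => l; rewrite mxE summxE; apply: eq_bigr => a _.
      by rewrite summxE; apply: eq_bigr => b _; rewrite !mxE.
    rewrite mulmx_sumr mulmx_sumr summxE mulr_sumr; apply: eq_bigr => a _.
    rewrite mulmx_sumr mulmx_sumr summxE mulr_sumr; apply: eq_bigr => b _.
    rewrite -!scalemxAr mxE mulrCA -sum_christoffel; congr (_ * _).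
    by apply: eq_bigr => k _; rewrite mxE.
  rewrite -!scalemxAr mulKmx// mxE mulrA mulVf// mul1r mxE.
  by apply: eq_bigr => k _; rewrite !mxE mulrC.
rewrite partial2_comp// big_split /= [X in _ - X]addrC opprD addrA.
have K (u v : R) : u + v - u = v by rewrite addrC addKr.
rewrite K.
rewrite [RHS]mxE.
under [RHS]eq_bigr do rewrite mxE mulr_suml.
rewrite [RHS]exchange_big -sumrB /=; apply: eq_bigr => a _.
rewrite mulr_sumr -sumrB; apply: eq_bigr => b _.
rewrite !mxE; ring.
Qed.

End Pullback.
End Christoffel.

(** * Charts and transition matrices *)

Section Charts.
Context {R : realType} {n : nat}.

Section OneChart.
Context {X : topologicalType} (c : chart R n X).

Lemma cinv_dom y : cimg c y -> cdom c (cinv c y).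
Proof. by case=> x cx <-; rewrite cfunK. Qed.

Lemma cinvK y : cimg c y -> cfun c (cinv c y) = y.
Proof. by case=> x cx <-; rewrite cfunK. Qed.

Lemma cimg_cfun x : cdom c x -> cimg c (cfun c x).
Proof. by move=> cx; exists x. Qed.

Lemma near_cdom x : cdom c x -> \forall x' \near x, cdom c x'.
Proof. by move=> cx; apply: open_nbhs_nbhs; split=> //; exact: cdom_open. Qed.

Lemma near_cimg y : cimg c y -> \forall y' \near y, cimg c y'.
Proof. by move=> cy; apply: open_nbhs_nbhs; split=> //; exact: cimg_open. Qed.

Lemma cfun_cvg x : cdom c x -> cfun c x' @[x' --> x] --> cfun c x.
Proof.
move=> cx; have := @cfun_continuous _ _ _ c.
rewrite continuous_open_subspace; last exact: cdom_open.
by apply; rewrite inE.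
Qed.

Lemma cinv_cvg y : cimg c y -> cinv c y' @[y' --> y] --> cinv c y.
Proof.
move=> cy; have := @cinv_continuous _ _ _ c.
rewrite continuous_open_subspace; last exact: cimg_open.
by apply; rewrite inE.
Qed.

End OneChart.

Variable M : manifold R n.
Implicit Types (a b c : chart R n M) (x : M) (y : 'rV[R]_n).

Lemma near_overlap a b x : cdom a x -> cdom b x ->
  \forall y \near cfun a x, (cfun a @` (cdom a `&` cdom b)) y.
Proof.
move=> ax bx; have iy := cimg_cfun ax.
have H : \forall y \near cfun a x, cdom b (cinv a y).
  by have := cinv_cvg iy; apply; rewrite cfunK//; exact: near_cdom.
apply: filterS2 (near_cimg iy) H => y cy by'.
by exists (cinv a y); [split=> //; exact: cinv_dom|rewrite cinvK].
Qed.

Lemma transition_map_differentiable a b x : atlas a -> atlas b ->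
  cdom a x -> cdom b x -> differentiable (cfun b \o cinv a) (cfun a x).
Proof.
move=> Aa Ab ax bx; apply: (atlas_smooth Aa Ab [::]).
by exists x.
Qed.

Lemma transition_map_diff2 a b x k : atlas a -> atlas b ->
  cdom a x -> cdom b x -> diff2 (coord (cfun b \o cinv a) k) (cfun a x).
Proof.
move=> Aa Ab ax bx; have sm := atlas_smooth Aa Ab.
have nd : \forall y \near cfun a x, differentiable (cfun b \o cinv a) y.
  by apply: filterS (near_overlap ax bx) => y; exact: (sm [::]).
split; first by apply: filterS nd => y; exact: differentiable_coordP.
move=> i.
apply: (@near_eq_differentiable _ _ _ (coord (partial i (cfun b \o cinv a)) k)).
  by apply: filterS nd => y dy; rewrite partial_coord.
by apply: differentiable_coordP; apply: (sm [:: i]); exists x.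
Qed.

Lemma mul_jacobian m p (f : 'rV[R]_m -> 'rV[R]_p) (z v : 'rV[R]_m) :
  v *m 'J f z = 'd f z v.
Proof. by rewrite /jacobian mul_rV_lin1. Qed.

(** A transition matrix depends only on the germ of the map. Identities between charts, which hold
    only near the point, thereby yield matrix identities. *)
Lemma transition_near a b x (f : 'rV[R]_n -> 'rV[R]_n) : atlas a -> atlas b ->
  cdom a x -> cdom b x -> {near cfun a x, f =1 cfun b \o cinv a} ->
  forall v, 'D_v f (cfun a x) = v *m transition a b x.
Proof.
move=> Aa Ab ax bx E v; rewrite (near_eq_derive v E).
by rewrite deriveEjacobian//; exact: transition_map_differentiable.
Qed.

Lemma transitionxx a x : atlas a -> cdom a x -> transition a a x = 1%:M.
Proof.
move=> Aa ax; apply/row_matrixP => i; rewrite !rowE.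
rewrite -(@transition_near a a x id) ?derive_id ?mulmx1//.
by apply: filterS (near_cimg (cimg_cfun ax)) => y cy /=; rewrite cinvK.
Qed.

Lemma transition_trans a b c x : atlas a -> atlas b -> atlas c ->
  cdom a x -> cdom b x -> cdom c x ->
  transition a c x = transition a b x *m transition b c x.
Proof.
move=> Aa Ab Ac ax bx cx; apply/row_matrixP => i; rewrite !rowE mulmxA.
pose f := (cfun c \o cinv b) \o (cfun b \o cinv a).
have fE : {near cfun a x, f =1 cfun c \o cinv a}.
  apply: filterS (near_overlap ax bx) => y [x' [ax' bx'] <-] /=.
  by rewrite /f /= cfunK// cfunK.
rewrite -[LHS](transition_near Aa Ac ax cx fE).
have d1 := transition_map_differentiable Aa Ab ax bx.
have d2 := transition_map_differentiable Ab Ac bx cx.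
have E : (cfun b \o cinv a) (cfun a x) = cfun b x by rewrite /= cfunK.
rewrite -E in d2; rewrite deriveE; last exact: differentiable_comp.
by rewrite /f diff_comp//= -!mul_jacobian /transition -[cfun b x]E.
Qed.

(** By the cocycle identity the transition back is an inverse. *)
Lemma transition_unit a b x : atlas a -> atlas b -> cdom a x -> cdom b x ->
  transition a b x \in unitmx.
Proof.
move=> Aa Ab ax bx; apply: (mulmx1_unit (B := transition b a x) _).1.
by rewrite -transition_trans// transitionxx.
Qed.

End Charts.

(** * The metric in charts and the change of chart for gradients and Hessians *)

Section MetricInCharts.
Context {R : realType} {n : nat} {M : riemannian R n}.
Implicit Types (a b c : chart R n M) (x : M) (y : 'rV[R]_n).

Lemma gmx_cfun c x : cdom c x -> gmx c (cfun c x) =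
  transition c (chart_at x) x *m metric x *m (transition c (chart_at x) x)^T.
Proof. by move=> cx; rewrite /gmx /form_in_chart cfunK. Qed.

Lemma gmx_sym c y : (gmx c y)^T = gmx c y.
Proof. by rewrite /gmx /form_in_chart !trmx_mul trmxK Defs.metric_sym mulmxA. Qed.

Lemma gmx_change a c x : atlas a -> atlas c -> cdom a x -> cdom c x ->
  gmx c (cfun c x) = transition c a x *m gmx a (cfun a x) *m (transition c a x)^T.
Proof.
move=> Aa Ac ax cx; rewrite (gmx_cfun ax) (gmx_cfun cx).
rewrite (transition_trans Ac Aa (chart_at_atlas x) cx ax (chart_at_dom x)).
by rewrite trmx_mul !mulmxA.
Qed.

Lemma pos_unitmx (A : 'M[R]_n) :
  (forall v : 'rV[R]_n, v != 0 -> 0 < (v *m A *m v^T) 0 0) -> A \in unitmx.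
Proof.
move=> H; rewrite -row_free_unit -kermx_eq0; apply/rowV0P => v /sub_kermxP vA.
apply/eqP/negP => /negP v0; have := H v v0.
by rewrite vA mul0mx mxE ltxx.
Qed.

Lemma gmx_pos c x (v : 'rV[R]_n) : atlas c -> cdom c x -> v != 0 ->
  0 < (v *m gmx c (cfun c x) *m v^T) 0 0.
Proof.
move=> Ac cx v0; rewrite gmx_cfun//; set P := transition _ _ _.
have uP : P \in unitmx.
  by apply: transition_unit => //; [exact: chart_at_atlas|exact: chart_at_dom].
have -> : v *m (P *m metric x *m P^T) *m v^T = (v *m P) *m metric x *m (v *m P)^T.
  by rewrite trmx_mul !mulmxA.
apply: metric_pos; apply: contraNneq v0 => vP.
by rewrite -(mulmxK uP v) vP mul0mx.
Qed.

Lemma gmx_unit c x : atlas c -> cdom c x -> gmx c (cfun c x) \in unitmx.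
Proof. by move=> Ac cx; apply: pos_unitmx => v; exact: gmx_pos. Qed.

Lemma gmx_differentiable c x (i j : 'I_n) : atlas c -> cdom c x ->
  differentiable (fun z => gmx c z i j) (cfun c x).
Proof.
move=> Ac cx; have dg : differentiable (gmx c) (cfun c x).
  by apply: (metric_smooth Ac [::]); exact: cimg_cfun.
apply: (@differentiable_comp _ _ _ _ (gmx c) (fun N : 'M[R]_n => N i j)) => //.
exact: differentiable_coord.
Qed.

Lemma gmx_partial_differentiable c x (i j k : 'I_n) : atlas c -> cdom c x ->
  differentiable (partial k (fun z => gmx c z i j)) (cfun c x).
Proof.
move=> Ac cx.
have dg : \forall y \near cfun c x, differentiable (gmx c) y.
  apply: filterS (near_cimg (cimg_cfun cx)) => y.
  exact: (metric_smooth Ac [::]).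
apply: (@near_eq_differentiable _ _ _ (fun y => partial k (gmx c) y i j)).
  apply: filterS dg => y dy; rewrite {1}/partial derive_mx ?mxE//.
  exact: diff_derivable.
apply: (@differentiable_comp _ _ _ _ (partial k (gmx c)) (fun N : 'M[R]_n => N i j)).
  by apply: (metric_smooth Ac [:: k]); exact: cimg_cfun.
exact: differentiable_coord.
Qed.

Section ChangeOfChart.
Variables (a c : chart R n M) (x : M).
Hypotheses (Aa : atlas a) (Ac : atlas c) (ax : cdom a x) (cx : cdom c x).

Let t := cfun a \o cinv c.

Let tE : t (cfun c x) = cfun a x. Proof. by rewrite /t /= cfunK. Qed.

Let JE z : cdom a z -> cdom c z ->
  transition c a z = \matrix_(i, k) partial i (coord t k) (cfun c z).
Proof.
move=> az cz; apply/matrixP => i k; rewrite [RHS]mxE.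
by rewrite -jacobian_partial//; exact: transition_map_differentiable.
Qed.

Let pullback_gmx : \forall z \near cfun c x, gmx c z =
  (\matrix_(i, k) partial i (coord t k) z) *m gmx a (t z) *m
  (\matrix_(i, k) partial i (coord t k) z)^T.
Proof.
apply: filterS (near_overlap cx ax) => _ [x' [cx' ax'] <-].
have tE' : t (cfun c x') = cfun a x' by rewrite /t /= cfunK.
by rewrite tE' -(JE ax' cx') (gmx_change Aa Ac ax' cx').
Qed.

Lemma chart_gradient (f : 'rV[R]_n -> R) : diff2 f (cfun a x) ->
  gradient (f \o t) (cfun c x) = transition c a x *m gradient f (cfun a x).
Proof.
move=> df; rewrite JE// -tE; apply: gradient_pullback; rewrite ?tE//.
by move=> k; exact: transition_map_diff2.
Qed.

Lemma chart_hessian (f : 'rV[R]_n -> R) : diff2 f (cfun a x) ->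
  covariant_hessian (gmx c) (f \o t) (cfun c x) =
  transition c a x *m covariant_hessian (gmx a) f (cfun a x) *m (transition c a x)^T.
Proof.
move=> df; rewrite JE// -tE; apply: covariant_hessian_pullback; rewrite ?tE//.
- by move=> k; exact: transition_map_diff2.
- by move=> i j; exact: gmx_differentiable.
- by move=> z; exact: gmx_sym.
- by rewrite -(JE ax cx); exact: transition_unit.
- exact: gmx_unit.
Qed.

End ChangeOfChart.

End MetricInCharts.

Lemma within_near_cvg (X Y : topologicalType) (D : set X) (f : X -> Y) (x : X) :
  nbhs x D -> {within D, continuous f} -> f x' @[x' --> x] --> f x.
Proof.
move=> Dx /subspace_continuousP cf W fW.
have := cf _ (nbhs_singleton Dx) W fW.
by apply: filterS2 Dx => x' Dx'; apply.
Qed.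

Lemma near_pair (X Y : topologicalType) (P : set X) (Q : set Y) (x : X) (y : Y) :
  nbhs x P -> nbhs y Q -> \forall w \near (x, y), P w.1 /\ Q w.2.
Proof. by move=> xP yQ; exists (P, Q). Qed.

Lemma near_section1 (X Y : topologicalType) (P : set (X * Y)) (x : X) (y : Y) :
  nbhs (x, y) P -> \forall x' \near x, P (x', y).
Proof.
move=> [[A B] /= [xA yB] AB]; apply: filterS xA => x' Ax'; apply: AB; split=> //.
exact: nbhs_singleton yB.
Qed.

Lemma near_section2 (X Y : topologicalType) (P : set (X * Y)) (x : X) (y : Y) :
  nbhs (x, y) P -> \forall y' \near y, P (x, y').
Proof.
move=> [[A B] /= [xA yB] AB]; apply: filterS yB => y' By'; apply: AB; split=> //.
exact: nbhs_singleton xA.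
Qed.

Lemma cvg_slice (X Y Z : topologicalType) (f : X * Y -> Z) (x : X) (y : Y) (l : Z) :
  f w @[w --> (x, y)] --> l -> f (x, y') @[y' --> y] --> l.
Proof.
move=> fl; apply: (@cvg_comp _ _ _ (fun y' => (x, y')) f (nbhs y) (nbhs (x, y))) => //.
by apply: cvg_pair; [exact: cvg_cst|exact: cvg_id].
Qed.

Section NearEqJets.
Context {R : realType} {n : nat}.

Lemma near_eq_gradient (f g : 'rV[R]_n -> R) y : {near y, f =1 g} ->
  gradient f y = gradient g y.
Proof.
by move=> fg; apply/colP => i; rewrite !mxE; exact: near_eq_derive.
Qed.

Lemma near_eq_covariant_hessian G (f g : 'rV[R]_n -> R) y : {near y, f =1 g} ->
  covariant_hessian G f y = covariant_hessian G g y.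
Proof.
move=> fg; apply/matrixP => i j; rewrite [LHS]mxE [RHS]mxE.
rewrite [partial j (partial i f) y](near_eq_derive _ (near_eq_partial i fg)).
congr (_ + - _); apply: eq_bigr => k _.
by rewrite [partial k f y](near_eq_derive _ fg).
Qed.

End NearEqJets.

(** * Jets of functions of class C12 *)

Section SpaceTimeJets.
Context {R : realType} {n : nat} {M : riemannian R n}.
Implicit Types (a c : chart R n M) (s : R) (x : M) (psi : R * M -> R).

(** At frozen time, [xpartial] of [in_chart] is convertible to [partial] of this function, so the
    calculus on row vectors applies. *)
Definition chart_slice a psi s : 'rV[R]_n -> R := fun y => in_chart a psi (s, y).

Lemma near_time (T s : R) : 0 < s < T -> \forall s' \near s, 0 < s' < T.
Proof.
move=> sT; have : \forall s' \near s, s' \in `]0, T[ by apply: near_in_itvoo; rewrite in_itv.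
by apply: filterS => s'; rewrite in_itv.
Qed.

Lemma near_slab T a s y : 0 < s < T -> cimg a y ->
  \forall w \near (s, y), (`[0, T] `*` cimg a) w.
Proof.
move=> sT ay; apply: filterS (near_pair (near_time sT) (near_cimg ay)).
by move=> w [/andP[s0 s1] wa]; split=> //=; rewrite in_itv /= !ltW.
Qed.

Section C12.
Variables (T : R) (psi : R * M -> R).
Hypothesis psiC : C12 T psi.

Lemma C12_cvg s x : 0 < s < T -> psi w @[w --> (s, x)] --> psi (s, x).
Proof.
move=> sT; have [cpsi _ _ _] := psiC.
apply: (within_near_cvg _ cpsi).
apply: filterS (near_pair (near_time sT) (@filterT _ (nbhs x) _)).
by move=> w [/andP[s0 s1] _]; split=> //=; rewrite in_itv /= !ltW.
Qed.

Lemma C12_tderiv_cvg s x : 0 < s < T ->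
  tderiv T psi w @[w --> (s, x)] --> tderiv T psi (s, x).
Proof.
move=> sT; have [_ _ cpsi _] := psiC.
apply: (within_near_cvg _ cpsi).
apply: filterS (near_pair (near_time sT) (@filterT _ (nbhs x) _)).
by move=> w [/andP[s0 s1] _]; split=> //=; rewrite in_itv /= !ltW.
Qed.

Lemma C12_partial_cvg a s y i : atlas a -> 0 < s < T -> cimg a y ->
  xpartial i (in_chart a psi) w @[w --> (s, y)] --> partial i (chart_slice a psi s) y.
Proof.
move=> Aa sT ay; have [_ _ _ H] := psiC; have [_ H1 _ _] := H a Aa i i.
exact: (within_near_cvg (near_slab sT ay) H1).
Qed.

Lemma C12_partial2_cvg a s y i j : atlas a -> 0 < s < T -> cimg a y ->
  xpartial j (xpartial i (in_chart a psi)) w @[w --> (s, y)] -->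
  partial j (partial i (chart_slice a psi s)) y.
Proof.
move=> Aa sT ay; have [_ _ _ H] := psiC; have [_ _ _ H1] := H a Aa i j.
exact: (within_near_cvg (near_slab sT ay) H1).
Qed.

(** [C12] provides continuous partials only. [C1_differentiable] upgrades them to Fréchet
    differentiability, once for the slice near [y] and once for its first partials at [y]. *)
Lemma C12_diff2 a s y : atlas a -> 0 < s < T -> cimg a y ->
  diff2 (chart_slice a psi s) y.
Proof.
move=> Aa sT ay; have [_ _ _ H] := psiC.
have sT' : s \in `[0, T] by move/andP: sT => [s0 s1]; rewrite in_itv /= !ltW.
split.
  apply: filterS (near_cimg ay) => z az; apply: C1_differentiable => i.
    have [H1 _ _ _] := H a Aa i i.
    by apply: filterS (near_cimg az) => z' az'; exact: (H1 (s, z')).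
  exact: (cvg_slice (C12_partial_cvg (i := i) Aa sT az)).
move=> i; apply: C1_differentiable => j.
  have [_ _ H1 _] := H a Aa i j.
  by apply: filterS (near_cimg ay) => z' az'; exact: (H1 (s, z')).
exact: (cvg_slice (C12_partial2_cvg (i := i) (j := j) Aa sT ay)).
Qed.

Lemma chart_slice_change a c s x : cdom a x -> cdom c x ->
  {near cfun c x, chart_slice c psi s =1
     chart_slice a psi s \o (cfun a \o cinv c)}.
Proof.
move=> ax cx; apply: filterS (near_overlap cx ax) => _ [x' [cx' ax'] <-].
by rewrite /chart_slice /in_chart /= !cfunK.
Qed.

(** Separates the possibly discontinuous dependence on [chart_at x], confined to the transition
    matrix, from components in a fixed chart that vary continuously. *)
Lemma xdiff_in_chart a s x : atlas a -> cdom a x -> 0 < s < T ->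
  xdiff psi (s, x) = transition (chart_at x) a x *m
    gradient (chart_slice a psi s) (cfun a x).
Proof.
move=> Aa ax sT; have Ac := chart_at_atlas x; have cx := chart_at_dom x.
rewrite -(chart_gradient Aa Ac ax cx); last first.
  exact: C12_diff2 (cimg_cfun ax).
exact: near_eq_gradient (chart_slice_change s ax cx).
Qed.

Lemma xhess_in_chart a s x : atlas a -> cdom a x -> 0 < s < T ->
  xhess psi (s, x) = transition (chart_at x) a x *m
    covariant_hessian (gmx a) (chart_slice a psi s) (cfun a x) *m
    (transition (chart_at x) a x)^T.
Proof.
move=> Aa ax sT; have Ac := chart_at_atlas x; have cx := chart_at_dom x.
rewrite -(chart_hessian Aa Ac ax cx); last first.
  exact: C12_diff2 (cimg_cfun ax).
exact: near_eq_covariant_hessian (chart_slice_change s ax cx).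
Qed.

End C12.

Lemma christoffel_cvg a x (k i j : 'I_n) : atlas a -> cdom a x ->
  christoffel_of (gmx a) k i j y @[y --> cfun a x] -->
  christoffel_of (gmx a) k i j (cfun a x).
Proof.
move=> Aa ax.
have gcv : gmx a y @[y --> cfun a x] --> gmx a (cfun a x).
  apply: (@cvg_mx R _ (nbhs (cfun a x))) => p q.
  by apply: differentiable_continuous; exact: gmx_differentiable.
have FF : Filter (nbhs (cfun a x)) := nbhs_filter _.
have icv := @cvg_invmx R _ _ FF _ _ _ (gmx_unit Aa ax) gcv.
rewrite /christoffel_of.
apply: (@cvgM _ _ _ _ (cst 2^-1)); first exact: cvg_cst.
apply: (@cvg_sumr R _ (nbhs (cfun a x))) => l.
apply: (@cvgM _ _ _ _ (fun y => invmx (gmx a y) k l)).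
  apply: (@cvg_comp _ _ _ (fun y => invmx (gmx a y)) (fun B : 'M[R]_n => B k l)
    _ (nbhs (invmx (gmx a (cfun a x))))) => //.
  exact: coord_continuous.
have d p q r : partial r (fun z => gmx a z p q) y @[y --> cfun a x] -->
    partial r (fun z => gmx a z p q) (cfun a x).
  by apply: differentiable_continuous; exact: gmx_partial_differentiable.
by apply: cvgB; first apply: cvgD.
Qed.

End SpaceTimeJets.

(** * The topology of the Riemannian distance *)

Section QuadraticForms.
Context {R : realType} {n : nat}.
Implicit Types (A : 'M[R]_n) (v : 'rV[R]_n).

Lemma quadratic_formE A v :
  (v *m A *m v^T) 0 0 = \sum_j \sum_i v 0 i * A i j * v 0 j.
Proof.
rewrite mxE; apply: eq_bigr => j _; rewrite !mxE mulr_suml.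
by apply: eq_bigr.
Qed.

Lemma quadratic_formZ A v (k : R) :
  ((k *: v) *m A *m (k *: v)^T) 0 0 = k ^+ 2 * (v *m A *m v^T) 0 0.
Proof. by rewrite linearZ /= -!scalemxAl -scalemxAr scalerA mxE -expr2. Qed.

Lemma quadratic_formB A B v : (v *m (A - B) *m v^T) 0 0 =
  (v *m A *m v^T) 0 0 - (v *m B *m v^T) 0 0.
Proof. by rewrite mulmxBr mulmxBl [LHS]mxE [X in _ + X]mxE. Qed.

Lemma quadratic_form_bound A v (e : R) : (forall i j, `|A i j| <= e) ->
  `|(v *m A *m v^T) 0 0| <= n%:R * (n%:R * e) * `|v| ^+ 2.
Proof.
move=> Ae; rewrite quadratic_formE -!mulrA.
apply: sum_entry_le => j; apply: sum_entry_le => i.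
rewrite !normrM (mulrC `|v 0 i|) -mulrA expr2.
by apply: ler_pM; rewrite ?mulr_ge0//; apply: ler_pM; rewrite ?entry_le_norm.
Qed.

(** The bound is the minimum of the form over the compact unit sphere, extended by homogeneity. *)
Lemma positive_form_lower_bound A :
  (forall v, v != 0 -> 0 < (v *m A *m v^T) 0 0) ->
  exists2 m : R, 0 < m & forall v, m * `|v| ^+ 2 <= (v *m A *m v^T) 0 0.
Proof.
move=> Apos; pose S := [set v : 'rV[R]_n | `|v| = 1].
have scale v : v != 0 -> S (`|v|^-1 *: v).
  by move=> v0; rewrite /S /= normrZ normfV normr_id mulVf// normr_eq0.
(* The sphere is empty exactly when all vectors are zero, that is, in dimension zero; any positive
   constant then works. *)
have [S0|/set0P SN] := eqVneq S set0.
  exists 1 => // v; have [->|v0] := eqVneq v 0.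
    by rewrite normr0 !mul0mx expr0n mulr0 mxE.
  by have := scale v v0; rewrite S0.
have cS : compact S.
  apply: bounded_closed_compact.
    by exists 1; split => // r r1 v /= ->; exact: ltW.
  have -> : S = (fun v : 'rV[R]_n => `|v|) @^-1` [set 1] by [].
  apply: preimage_closed; last exact: closed_eq.
  by move=> v _; exact: norm_continuous.
have cq : continuous (fun v : 'rV[R]_n => (v *m A *m v^T) 0 0).
  have -> : (fun v : 'rV[R]_n => (v *m A *m v^T) 0 0) =
      fun v => \sum_j \sum_i v 0 i * A i j * v 0 j.
    by apply/funext => v; rewrite quadratic_formE.
  move=> v; apply: (@cvg_sumr R _ (nbhs v)) => j; apply: (@cvg_sumr R _ (nbhs v)) => i.
  apply: cvgM; last exact: coord_continuous.
  by apply: cvgM; [exact: coord_continuous|exact: cvg_cst].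
have [w wS wmin] := EVT_min_rV SN cS (continuous_subspaceT cq).
have w0 : w != 0.
  by apply/eqP => w0; move: wS; rewrite inE /S /= w0 normr0 => /eqP; rewrite eq_sym oner_eq0.
exists ((w *m A *m w^T) 0 0); first exact: Apos.
move=> v; have [->|v0] := eqVneq v 0.
  by rewrite normr0 !mul0mx expr0n mulr0 mxE.
have nv : 0 < `|v| by rewrite normr_gt0.
have := wmin (`|v|^-1 *: v); rewrite inE => /(_ (scale v v0)).
by rewrite quadratic_formZ exprVn ler_pdivlMl ?exprn_gt0// mulrC.
Qed.

End QuadraticForms.

Section LocalMetricBounds.
Context {R : realType} {n : nat} {M : riemannian R n}.
Variables (c : chart R n M) (x : M).
Hypotheses (Ac : atlas c) (cx : cdom c x).

Lemma near_gmx_entries (e : R) : 0 < e ->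
  \forall y \near cfun c x, forall i j, `|(gmx c y - gmx c (cfun c x)) i j| <= e.
Proof.
move=> e0; have H : \forall y \near cfun c x, forall ij : 'I_n * 'I_n,
    `|gmx c (cfun c x) ij.1 ij.2 - gmx c y ij.1 ij.2| <= e.
  apply: (@filter_forall _ _ _ (nbhs (cfun c x))) => -[i j] /=.
  have := differentiable_continuous (gmx_differentiable i j Ac cx).
  by move=> /cvgrPdist_le /(_ e e0).
apply: filterS H => y Hy i j.
by rewrite [_ i j]mxE [X in _ + X]mxE distrC; exact: (Hy (i, j)).
Qed.

Lemma near_metric_lower_bound : exists2 m : R, 0 < m &
  \forall y \near cfun c x, forall v : 'rV[R]_n, m * `|v| ^+ 2 <= (v *m gmx c y *m v^T) 0 0.
Proof.
have [m m0 Hm] := positive_form_lower_bound (fun v => gmx_pos Ac cx (v := v)).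
exists (m / 2); first by rewrite divr_gt0.
(* Entries that change by at most [e] change the form by at most [n * n * e * |v| ^+ 2], so
   [e = m / 2 / N] loses at most half of [m]; the summand 1 keeps [N] positive. *)
pose N : R := n%:R * n%:R + 1.
have N0 : 0 < N by rewrite ltr_wpDl// mulr_ge0.
pose e := m / 2 / N.
have e0 : 0 < e by rewrite !divr_gt0.
apply: filterS (near_gmx_entries e0) => y Hy v.
have H1 := quadratic_form_bound v Hy; rewrite quadratic_formB in H1.
have He : n%:R * (n%:R * e) * `|v| ^+ 2 <= m / 2 * `|v| ^+ 2.
  apply: ler_wpM2r; first by rewrite exprn_ge0.
  rewrite mulrA /e mulrA ler_pdivrMr// mulrC ler_pM2l ?divr_gt0//.
  by rewrite lerDl.
have K (p q d f : R) : `|p - q| <= f -> m * d <= q -> f <= m / 2 * d ->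
    m / 2 * d <= p by rewrite ler_norml => /andP[? _] ? ?; lra.
exact: K H1 (Hm v) He.
Qed.

Lemma near_metric_upper_bound : exists2 C : R, 0 < C &
  \forall y \near cfun c x, forall v : 'rV[R]_n, (v *m gmx c y *m v^T) 0 0 <= C * `|v| ^+ 2.
Proof.
pose B : R := `|gmx c (cfun c x)| + 1.
have B0 : 0 < B by rewrite ltr_wpDl.
exists (n%:R * (n%:R * B) + 1).
  by rewrite ltr_wpDl// !mulr_ge0// ltW.
apply: filterS (near_gmx_entries ltr01) => y Hy v.
apply: le_trans (ler_norm _) _.
have HB i j : `|gmx c y i j| <= B.
  have := Hy i j; rewrite [_ i j]mxE [X in _ + X]mxE => H1.
  have H2 : `|gmx c (cfun c x) i j| <= `|gmx c (cfun c x)|.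
    by rewrite [leRHS]/Num.norm /= mx_normrE; exact: (le_bigmax _ _ (i, j)).
  rewrite -(subrK (gmx c (cfun c x) i j) (gmx c y i j)).
  by rewrite (le_trans (ler_normD _ _))// /B addrC lerD.
apply: le_trans (quadratic_form_bound v HB) _.
by apply: ler_wpM2r; rewrite ?exprn_ge0// lerDl.
Qed.

End LocalMetricBounds.

(** * Difference quotients, relative derivatives and the speed of a curve *)

Section Velocities.
Context {R : realType}.

(** Chain rule along an arbitrary filter, with [k] in the role of the reciprocal increment; it
    covers quotients relative to an interval, one-sided at its ends. *)
Lemma quotient_comp (S : Type) (F : set_system S) (FF : Filter F)
    (V W : normedModType R) (k : S -> R) (y : S -> V) (y0 v : V) (f : V -> W) :
  y h @[h --> F] --> y0 -> k h *: (y h - y0) @[h --> F] --> v ->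
  differentiable f y0 -> k h *: (f (y h) - f y0) @[h --> F] --> 'd f y0 v.
Proof.
move=> yc kc df.
have dc : 'd f y0 (k h *: (y h - y0)) @[h --> F] --> 'd f y0 v.
  apply: (@cvg_comp _ _ _ (fun h => k h *: (y h - y0)) ('d f y0) F (nbhs v)) => //.
  exact: (diff_continuous df).
apply/cvgrPdist_le => e e0.
(* Eventually [|k h *: (y h - y0)| <= |v| + 1], so the remainder of the expansion of [f] contributes
   at most [e / 2]. *)
pose e1 := e / 2 / (`|v| + 1).
have v1 : 0 < `|v| + 1 by rewrite ltr_wpDl.
have e10 : 0 < e1 by rewrite !divr_gt0.
have H1 : \forall h \near F, `|f (y h) - (f y0 + 'd f y0 (y h - y0))| <= e1 * `|y h - y0|.
  exact: (yc _ (differentiable_near df e10)).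
have H2 : \forall h \near F, `|'d f y0 v - 'd f y0 (k h *: (y h - y0))| <= e / 2.
  by have /cvgrPdist_le := dc; apply; rewrite divr_gt0.
have H3 : \forall h \near F, `|v - k h *: (y h - y0)| <= 1.
  by have /cvgrPdist_le := kc; exact.
apply: filterS3 H1 H2 H3 => h H1 H2 H3.
rewrite linearZ /= in H2.
have -> : 'd f y0 v - k h *: (f (y h) - f y0) =
   ('d f y0 v - k h *: 'd f y0 (y h - y0)) -
   k h *: (f (y h) - (f y0 + 'd f y0 (y h - y0))).
  by rewrite opprD addrA [in RHS]scalerBr opprB addrA subrK.
rewrite (le_trans (ler_normB _ _))// (splitr e) lerD//.
rewrite normrZ (le_trans (ler_wpM2l (normr_ge0 _) H1))// mulrCA -normrZ.
rewrite /e1 mulrAC ler_pdivrMr// ler_pM2l ?divr_gt0//.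
by rewrite -(subKr v (k h *: _)) (le_trans (ler_normB _ _))// lerD2l.
Qed.

End Velocities.

Section RelativeDerivative.
Context {R : realType}.

(** Every point of a nondegenerate interval is an accumulation point, which makes limits unique and
    lets [cvg_lim] evaluate [derive_in]. *)
Lemma within_itv_proper (p q s : R) : p < q -> s \in `[p, q] ->
  ProperFilter (within `[p, q]%classic s^').
Proof.
move=> pq; rewrite in_itv /= => /andP[ps sq].
apply: Build_ProperFilter_ex => P /= [e /= e0 H].
have [sq'|qs] := ltP s q.
  pose d := Num.min (e / 2) (q - s).
  have d0 : 0 < d by rewrite lt_min divr_gt0//= subr_gt0.
  have d1 : d < e by rewrite (@le_lt_trans _ _ (e / 2)) ?ge_min ?lexx// ltr_pdivrMr// ltr_pMr// ltr1n.
  exists (s + d); apply: H => /=.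
  - by rewrite opprD addrA subrr sub0r normrN gtr0_norm.
  - by rewrite -subr_eq0 addrAC subrr add0r gt_eqF.
  - rewrite in_itv /=; apply/andP; split; first by rewrite (le_trans ps)// lerDl ltW.
    by rewrite -lerBrDl /d ge_min lexx orbT.
have sE : s = q by apply/eqP; rewrite eq_le sq.
pose d := Num.min (e / 2) (s - p).
have d0 : 0 < d by rewrite lt_min divr_gt0//= subr_gt0 sE.
have d1 : d < e by rewrite (@le_lt_trans _ _ (e / 2)) ?ge_min ?lexx// ltr_pdivrMr// ltr_pMr// ltr1n.
exists (s - d); apply: H => /=.
- by rewrite opprB addrC subrK gtr0_norm.
- by rewrite -subr_eq0 addrAC subrr add0r oppr_eq0 gt_eqF.
- rewrite in_itv /=; apply/andP; split; last by rewrite (le_trans _ sq)// gerBl ltW.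
  by rewrite lerBrDr -lerBrDl /d ge_min lexx orbT.
Qed.

Lemma within_interior (D : set R) (s : R) : nbhs s D -> within D s^' = s^'.
Proof.
move=> sD; apply/predeqP => P; split=> H.
  have D' : \forall h \near s^', D h by apply: nbhs_dnbhs.
  by apply: filterS2 D' H => h Dh; apply.
by apply: filterS H => h.
Qed.

Lemma cvg_quotient_is_derive (V : normedModType R) (f : R -> V) (s : R) (l : V) :
  (h - s)^-1 *: (f h - f s) @[h --> s^'] --> l -> is_derive s 1 f l.
Proof.
move=> H.
have K : h^-1 *: ((f \o shift s) (h *: 1) - f s) @[h --> 0^'] --> l.
  rewrite [X in X @ _](_ : _ = (fun h => (h - s)^-1 *: (f h - f s)) \o (fun h => h + s)).
    apply: (@cvg_comp _ _ _ (fun h => h + s) (fun h => (h - s)^-1 *: (f h - f s))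
      _ (s^')) H => P /= [e /= e0 He].
    exists e => // h /=; rewrite sub0r normrN => he h0; apply: He => /=.
      by rewrite opprD addrCA subrr addr0 normrN.
    by rewrite -subr_eq0 addrK.
  by apply/funext => h /=; rewrite [h *: 1]mulr1 addrK.
by apply: DeriveDef; [apply/cvg_ex; exists l|exact: cvg_lim].
Qed.

Lemma is_derive_cvg_quotient (V : normedModType R) (f : R -> V) (s : R) (l : V) :
  is_derive s 1 f l -> (h - s)^-1 *: (f h - f s) @[h --> s^'] --> l.
Proof.
case=> df <-; rewrite [X in X @ _](_ : _ =
    (fun h => h^-1 *: ((f \o shift s) (h *: 1) - f s)) \o (fun h => h - s)).
  apply: (@cvg_comp _ _ _ (fun h => h - s)
    (fun h => h^-1 *: ((f \o shift s) (h *: 1) - f s)) _ (0^')) df => P /= [e /= e0 He].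
  exists e => // h /= he hs; apply: He => /=; first by rewrite sub0r opprB.
  by rewrite subr_eq0.
by apply/funext => h /=; rewrite [(h - s) *: 1]mulr1 subrK.
Qed.

Lemma derivable_in_cvg (V : normedModType R) (D : set R) (f : R -> V) (s : R) :
  derivable_in D f s ->
  (h - s)^-1 *: (f h - f s) @[h --> within D s^'] --> derive_in D f s.
Proof. by move=> H; exact: H. Qed.

Lemma derivable_in_is_derive (V : normedModType R) (D : set R) (f : R -> V) (s : R) :
  nbhs s D -> derivable_in D f s -> is_derive s 1 f (derive_in D f s).
Proof.
move=> sD /derivable_in_cvg H; apply: cvg_quotient_is_derive.
by rewrite -(within_interior sD).
Qed.

Lemma is_derive_entry m p (f : R -> 'M[R]_(m, p)) (s : R) (l : 'M[R]_(m, p)) i j :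
  is_derive s 1 f l -> is_derive s 1 (fun h => f h i j) (l i j).
Proof.
case=> df <-; apply: DeriveDef; first by move/derivable_mxP: df.
by rewrite derive_mx// mxE.
Qed.

End RelativeDerivative.

Section Speed.
Context {R : realType} {n : nat} {M : riemannian R n}.
Implicit Types (c : chart R n M) (gamma : R -> M).

(** [speed] reads the velocity in a chart that changes along the curve. The transition matrix in the
    velocity matches the one in [gmx_cfun], so any chart of the atlas gives the same value. *)
Lemma speed_in_chart c gamma (s : R) (v : 'rV[R]_n) : atlas c -> 0 <= s <= 1 -> cdom c (gamma s) ->
  gamma h @[h --> within `[0, 1]%classic s^'] --> gamma s ->
  (h - s)^-1 *: (cfun c (gamma h) - cfun c (gamma s))
    @[h --> within `[0, 1]%classic s^'] --> v ->
  speed gamma s = Num.sqrt ((v *m gmx c (cfun c (gamma s)) *m v^T) 0 0).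
Proof.
move=> Ac s01 cs gs vs; set x := gamma s.
have PF : ProperFilter (within `[0, 1]%classic s^').
  by apply: within_itv_proper; rewrite ?ltr01// in_itv.
have Ax := chart_at_atlas x; have xx := chart_at_dom x.
have dtau := transition_map_differentiable Ac Ax cs xx.
have yc : cfun c (gamma h) @[h --> within `[0, 1]%classic s^'] --> cfun c x.
  exact: (@cvg_comp _ _ _ gamma (cfun c) _ (nbhs x) _ gs (cfun_cvg cs)).
have FF : Filter (within `[0, 1]%classic s^') by exact: (@filter_filter _ _ PF).
have := quotient_comp FF yc vs dtau.
rewrite -mul_jacobian => H.
have dE : derive_in `[0, 1]%classic (cfun (chart_at x) \o gamma) s =
    v *m transition c (chart_at x) x.
  apply: cvg_lim => //; apply: cvg_trans H; apply: near_eq_cvg.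
  have H1 : \forall h \near within `[0, 1]%classic s^', cdom c (gamma h).
    exact: (gs _ (near_cdom cs)).
  by apply: filterS H1 => h ch /=; rewrite !cfunK.
rewrite /speed /= -/x dE gmx_cfun//; congr (Num.sqrt (_ 0 0)).
by rewrite trmx_mul !mulmxA.
Qed.

End Speed.

Section IntegralMonotone.
Context {R : realType}.
Local Open Scope ereal_scope.

(* No measurability is assumed: the integral of a nonnegative function is a
   supremum over simple functions below it. *)
Lemma ge0_le_integral_setT (f g : R -> \bar R) : (forall s, 0 <= f s) ->
  (forall s, f s <= g s) ->
  \int[lebesgue_measure]_s f s <= \int[lebesgue_measure]_s g s.
Proof.
move=> f0 fg; have g0 s : 0 <= g s := le_trans (f0 s) (fg s).
rewrite !ge0_integralTE//; apply: ereal_sup_le => _ [h hf <-] /=.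
by exists h => // s; exact: le_trans (hf s) (fg s).
Qed.

End IntegralMonotone.

(** * Lower bound for the length of a curve that enters a chart ball *)

Section LengthLowerBound.
Context {R : realType} {n : nat} {M : riemannian R n}.
Variables (c : chart R n M) (x0 : M).
Hypotheses (Ac : atlas c) (cx0 : cdom c x0).
Let y0 := cfun c x0.

Definition chart_ball (l : R) : set M := [set x | cdom c x /\ `|cfun c x - y0| < l].
Definition chart_cball (l : R) : set M := [set x | cdom c x /\ `|cfun c x - y0| <= l].

Lemma near_chart_ball l x : chart_ball l x -> \forall x' \near x, chart_ball l x'.
Proof.
move=> [cx xl]; have H : \forall x' \near x, `|cfun c x' - y0| < l.
  have cn : `|cfun c x' - y0| @[x' --> x] --> `|cfun c x - y0|.
    apply: cvg_norm; apply: cvgB; last exact: cvg_cst.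
    exact: cfun_cvg.
  exact: (cvgr_lt _ cn).
by apply: filterS2 (near_cdom cx) H.
Qed.

(** Closed in [M], not just in the chart domain: the set is the image under [cinv] of a compact
    ball, hence compact, hence closed because [M] is Hausdorff. *)
Lemma chart_cball_closed l : (forall y, `|y - y0| <= l -> cimg c y) ->
  closed (chart_cball l).
Proof.
move=> Hl; pose D := [set y : 'rV[R]_n | `|y - y0| <= l].
have DE : chart_cball l = cinv c @` D.
  apply/seteqP; split => [x [cx xl]|_ [y yl <-]].
    by exists (cfun c x) => //; rewrite cfunK.
  have cy := Hl _ yl; split; first exact: cinv_dom.
  by rewrite cinvK.
rewrite DE; apply: compact_closed; first exact: m_hausdorff.
apply: continuous_compact.
  apply: continuous_subspaceW (@cinv_continuous _ _ _ c).
  by move=> y /Hl.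
apply: bounded_closed_compact.
  exists (l + `|y0|); split; first exact: num_real.
  move=> r lr y /= yl; apply/ltW; apply: le_lt_trans lr.
  by rewrite -(subrK y0 y) (le_trans (ler_normD _ _))// lerD2r.
have -> : D = (fun y => `|y - y0|) @^-1` [set t | t <= l] by [].
apply: preimage_closed; last exact: closed_le.
move=> y _; apply: (@cvg_norm _ _ _ (nbhs y)); apply: cvgB; [exact: cvg_id|exact: cvg_cst].
Qed.

Variables (lam rho : R).
Hypotheses (lam0 : 0 < lam) (rhoP : forall y, `|y - y0| <= rho ->
  cimg c y /\ forall v : 'rV[R]_n, lam * `|v| ^+ 2 <= (v *m gmx c y *m v^T) 0 0).

(** The times outside the open ball form a compact set; [s] is its maximum. Points just after [s]
    lie in the closed chart ball, so its closedness puts [gamma s] in the chart domain, at radius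
    exactly [l]. *)
Lemma last_exit gamma (p q l : R) : p < q ->
  {within `[p, q]%classic, continuous gamma} -> l <= rho ->
  ~ chart_ball l (gamma p) -> chart_ball l (gamma q) ->
  exists s, [/\ p <= s, s < q, cdom c (gamma s), `|cfun c (gamma s) - y0| = l &
    forall h, s < h -> h <= q -> chart_ball l (gamma h)].
Proof.
move=> pq cg lr gp gq; move/subspace_continuousP: (cg) => cgP.
pose S := [set s | `[p, q]%classic s /\ ~ chart_ball l (gamma s)].
have Sp : S p by split=> //=; rewrite in_itv /= lexx ltW.
have Scl : closed S.
  move=> s sS.
  have sI : `[p, q]%classic s.
    have : closed `[p, q]%classic by exact: interval_closed.
    by apply; apply: closureS sS => h [].
  split=> // Bs; have := cgP s sI _ (near_chart_ball Bs).
  move=> /sS [h [[hI hB] H]].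
  exact: hB (H hI).
have Sco : compact S.
  apply: (subclosed_compact Scl (@segment_compact _ p q)).
  by move=> s [].
have [|s sS smax] := @compact_EVT_max R R id S (ex_intro _ p Sp) Sco.
  by apply: continuous_subspaceT => ?; exact: cvg_id.
move: sS; rewrite inE => -[sI sB]; have := sI; rewrite /= in_itv /= => /andP[ps sq].
have sq' : s < q.
  by rewrite lt_neqAle sq andbT; apply/eqP => E; apply: sB; rewrite E.
have after h : s < h -> h <= q -> chart_ball l (gamma h).
  move=> sh hq; apply: contrapT => hB.
  have : h <= s.
    apply: smax; rewrite inE; split => //=.
    by rewrite in_itv /= hq (le_trans ps) ?ltW.
  by rewrite leNgt sh.
have Kc : closed (chart_cball l).
  apply: chart_cball_closed => y yl.
  by have [] := rhoP (le_trans yl lr).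
have sK : chart_cball l (gamma s).
  apply: contrapT => sK.
  have nK : nbhs (gamma s) (~` chart_cball l).
    by apply: open_nbhs_nbhs; split => //; exact: closed_openC.
  have H1 : \forall h \near s, `[p, q]%classic h -> ~ chart_cball l (gamma h).
    exact: cgP s sI _ nK.
  have H2 : \forall h \near s^'+, `[p, q]%classic h -> ~ chart_cball l (gamma h).
    exact: cvg_within.
  have /(_ _ _)/filter_ex[h [[sh hq] Hh]] :=
    filterI (filterI (nbhs_right_gt s) (nbhs_right_le sq')) H2.
  have [ch hl] := after h sh hq.
  apply: Hh; last by split => //; exact: ltW.
  by rewrite /= in_itv /= hq (le_trans ps) ?ltW.
have [cs sl] := sK.
exists s; split=> //; apply/eqP; rewrite eq_le sl leNgt; apply/negP => sl'.
by apply: sB.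
Qed.

(** After the last exit the curve stays in the chart and one coordinate moves by at least [l - m];
    the fundamental theorem of calculus bounds this by the integral of the modulus of its
    derivative. The minorant [k] is measurable by construction, so that pieces can be added without
    any measurability of [speed]. *)
Lemma piece_lower_bound gamma (p q l m : R) : p < q -> 0 <= p -> q <= 1 ->
  C1_curve_on `[p, q]%classic gamma -> l <= rho ->
  ~ chart_ball l (gamma p) -> cdom c (gamma q) -> `|cfun c (gamma q) - y0| = m ->
  m < l ->
  exists k : R -> R, [/\ measurable_fun setT k, forall s, 0 <= k s,
    forall s, ~~ (p < s < q) -> k s = 0,
    forall s, p < s < q -> k s <= speed gamma s &
    ((Num.sqrt lam * (l - m))%:E <=
      \int[lebesgue_measure]_s (k s)%:E)%E].
Proof.
move=> pq p0 q1 [cg C1] lr gp cq qm ml.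
have gq : chart_ball l (gamma q) by split=> //; rewrite qm.
have [s [ps sq cs sl after]] := last_exit pq cg lr gp gq.
have l0 : 0 < l by rewrite (le_lt_trans _ ml)// -qm.
have slE : mx_norm (cfun c (gamma s) - y0) = l := sl.
(* The coordinate that realizes the maximum norm at the exit point: it has displacement exactly [l]
   there and at most [m] at time [q]. *)
have [[i0 i] /= il] : exists i : 'I_1 * 'I_n,
    mx_norm (cfun c (gamma s) - y0) = `|(cfun c (gamma s) - y0) i.1 i.2|.
  by apply: mx_norm_neq0; rewrite slE gt_eqF.
rewrite (ord1 i0) slE in il.
move/subspace_continuousP: (cg) => cgP.
have [dY cY] := C1 c Ac.
pose Y := cfun c \o gamma.
pose V := derive_in `[p, q]%classic Y.
have inD h : s <= h -> h <= q -> `[p, q]%classic h.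
  by move=> sh hq; rewrite /= in_itv /= hq (le_trans ps).
have indom h : s <= h -> h <= q -> cdom c (gamma h).
  rewrite le_eqVlt => /predU1P[<-//|sh hq].
  by have [] := after h sh hq.
have intD h : s < h -> h < q -> nbhs h `[p, q]%classic.
  move=> sh hq; have : \forall h' \near h, h' \in `]p, q[.
    by apply: near_in_itvoo; rewrite in_itv /= hq (le_lt_trans ps).
  by apply: filterS => h'; rewrite /= !in_itv /= => /andP[/ltW -> /ltW].
have YV h : s < h -> h < q -> is_derive h 1 Y (V h).
  move=> sh hq; apply: derivable_in_is_derive; first exact: intD.
  by apply: dY; [apply: inD|apply: indom]; rewrite ltW.
pose f h := V h 0 i.
pose F h := Y h 0 i.
have fcont : {within `[s, q], continuous f}.
  have H : {within `[s, q], continuous V}.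
    apply: continuous_subspaceW cY => h /=; rewrite in_itv /= => /andP[sh hq].
    by split; [exact: inD|exact: indom].
  apply/subspace_continuousP => h hI; move/subspace_continuousP: H => /(_ h hI) H.
  apply: (@cvg_comp _ _ _ V (fun N : 'rV[R]_n => N 0 i) _ _ _ H).
  exact: coord_continuous.
have FV h : s < h -> h < q -> is_derive h 1 F (f h).
  by move=> sh hq; apply: is_derive_entry; exact: YV.
have Fcvg h : s <= h -> h <= q ->
    F h' @[h' --> within `[p, q]%classic (nbhs h)] --> F h.
  move=> sh hq.
  have H1 := @cvg_comp _ _ _ gamma (cfun c) _ (nbhs (gamma h)) _
    (cgP h (inD h sh hq)) (cfun_cvg (indom h sh hq)).
  apply: (@cvg_comp _ _ _ (cfun c \o gamma) (fun N : 'rV[R]_n => N 0 i) _ _ _ H1).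
  exact: coord_continuous.
have Fbnd : derivable_oo_LRcontinuous F s q.
  split.
  - by move=> h; rewrite in_itv /= => /andP[sh hq]; have [] := FV h sh hq.
  - move=> P FP; have H : \forall h \near s, `[p, q]%classic h -> P (F h).
      exact: Fcvg (lexx s) (ltW sq) P FP.
    have H1 : \forall h \near s^'+, `[p, q]%classic h -> P (F h) by exact: cvg_within.
    apply: filterS3 (nbhs_right_gt s) (nbhs_right_le sq) H1 => h sh hq; apply.
    exact: inD (ltW sh) hq.
  - move=> P FP; have H : \forall h \near q, `[p, q]%classic h -> P (F h).
      exact: Fcvg (ltW sq) (lexx q) P FP.
    have H1 : \forall h \near q^'-, `[p, q]%classic h -> P (F h) by exact: cvg_within.
    apply: filterS3 (nbhs_left_lt q) (nbhs_left_ge sq) H1 => h hq sh; apply.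
    exact: inD sh (ltW hq).
have fE : {in `]s, q[, F^`()%classic =1 f}.
  move=> h; rewrite in_itv /= => /andP[sh hq]; rewrite derive1E.
  by have [_ ->] := FV h sh hq.
have FTC := continuous_FTC2 sq fcont Fbnd fE.
have fmeas : measurable_fun `[s, q] f.
  by apply: subspace_continuous_measurable_fun.
have fmeas' : measurable_fun `]s, q[ f.
  by apply: measurable_funS fmeas => //; exact: subset_itv_oo_cc.
pose g h := Num.sqrt lam * `|f h|.
have gmeas : measurable_fun `]s, q[ g.
  by apply: measurable_funM => //; exact: measurableT_comp.
(* Cut off to an open interval, so that the minorants of consecutive pieces have disjoint
   supports. *)
exists (g \_ `]s, q[); split.
- by apply: (measurable_restrictT g _).1.
- move=> h; rewrite patchE; case: ifP => // _.
  by rewrite mulr_ge0 ?sqrtr_ge0.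
- move=> h hI; rewrite patchE; case: ifPn => //; rewrite inE /= in_itv /=.
  move=> /andP[sh hq]; move: hI; rewrite hq andbT -leNgt => hp.
  by have := lt_le_trans sh hp; rewrite ltNge ps.
- move=> h /andP[ph hq]; rewrite patchE; case: ifPn; last first.
    by move=> _; exact: sqrtr_ge0.
  rewrite inE /= in_itv /= => /andP[sh _].
  (* [speed] differentiates relative to [[0, 1]], [C1_curve_on] relative to [[p, q]]; at an interior
     point both filters are the punctured neighbourhoods. *)
  have h01 : nbhs h `[0, 1]%classic.
    apply: filterS (intD h sh hq) => h' /=; rewrite !in_itv /= => /andP[ph' hq'].
    by rewrite (le_trans p0 ph') (le_trans hq' q1).
  have ch := indom h (ltW sh) (ltW hq).
  have gh : gamma h' @[h' --> h] --> gamma h.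
    exact: (within_near_cvg (intD h sh hq) cg).
  rewrite (@speed_in_chart _ _ _ c gamma h (V h))//.
  + rewrite (_ : g h = Num.sqrt (lam * f h ^+ 2)); last first.
      by rewrite sqrtrM ?ltW// sqrtr_sqr.
    apply: ler_wsqrtr.
    have [_ H] := rhoP (ltW (lt_le_trans (after h sh (ltW hq)).2 lr)).
    apply: le_trans (H (V h)); rewrite ler_pM2l// -[f h ^+ 2]real_normK ?num_real//.
    by rewrite ler_sqr ?nnegrE// entry_le_norm.
  + by rewrite (le_trans p0 (ltW ph)) (le_trans (ltW hq) q1).
  + rewrite (within_interior h01); apply: cvg_trans gh.
    by apply: cvg_app; exact: cvg_within.
  + rewrite (within_interior h01) -(within_interior (intD h sh hq)).
    apply: derivable_in_cvg.
    by apply: dY; [apply: inD|apply: indom]; rewrite ltW.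
- rewrite (_ : (fun h => ((g \_ `]s, q[) h)%:E) = (EFin \o g) \_ `]s, q[); last first.
    by apply/funext => h; rewrite /= !patchE; case: ifP.
  rewrite -integral_mkcond.
  rewrite (_ : EFin \o g = fun h => ((Num.sqrt lam)%:E * `|(f h)%:E|)%E); last first.
    by apply/funext => h; rewrite /= -EFinM.
  have fmeasE : measurable_fun `]s, q[ (fun h => `|(f h)%:E|%E).
    by apply: measurableT_comp => //; exact/measurable_EFinP.
  rewrite ge0_integralZl_EFin ?sqrtr_ge0//; last first.
  rewrite EFinM lee_pmul2l ?lte_fin ?sqrtr_gt0//.
  rewrite -(integral_itv_bndoo true false)//.
  have fmeas2 : measurable_fun `[s, q] (EFin \o f) by exact/measurable_EFinP.
  apply: le_trans (le_abse_integral lebesgue_measure _ fmeas2) => //.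
  rewrite FTC -EFinB abse_EFin lee_fin.
  have Fq : `|F q - y0 0 i| <= m.
    by rewrite -qm; have := entry_le_norm (cfun c (gamma q) - y0) i; rewrite !mxE.
  have Fs : `|F s - y0 0 i| = l by rewrite il !mxE.
  rewrite lerBlDr -Fs distrC.
  by rewrite (le_trans (ler_distD (F q) _ _))// addrC lerD// distrC.
Qed.

(** Induction over the break points with the radius [l] varying: a piece that ends inside the ball
    at radius [m] accounts for [l - m], the remaining pieces for [m]. *)
Lemma path_lower_bound gamma (s : seq R) (p l : R) :
  path <%R p s -> last p s = 1 -> 0 <= p ->
  (forall i, (i < size s)%N ->
    C1_curve_on `[nth 0 (p :: s) i, nth 0 s i]%classic gamma) ->
  gamma 1 = x0 -> l <= rho -> ~ chart_ball l (gamma p) ->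
  exists k : R -> R, [/\ measurable_fun setT k, forall h, 0 <= k h,
    forall h, ~~ (p < h < 1) -> k h = 0,
    forall h, p < h < 1 -> k h <= speed gamma h &
    ((Num.sqrt lam * l)%:E <= \int[lebesgue_measure]_h (k h)%:E)%E].
Proof.
move=> + + + + g1.
(* With no piece left, [gamma p] is the centre [x0]; being outside the ball forces [l <= 0], and the
   zero minorant suffices. *)
elim: s p l => [|q s IH] p l /= ps ls p0 C1 lr gp.
  exists (cst 0); split=> //.
  - by move=> h _; exact: sqrtr_ge0.
  - rewrite integral0 lee_fin pmulr_rle0 ?sqrtr_gt0// leNgt; apply/negP => l0.
    by apply: gp; split; rewrite ls g1// subrr normr0.
move/andP: ps => [pq qs].
have q1 : q <= 1.
  rewrite -ls; elim: (s) (q) qs => [|a r IHr] b //= /andP[ba ar].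
  exact: le_trans (ltW ba) (IHr _ ar).
have q0 : 0 <= q := le_trans p0 (ltW pq).
have C1s i : (i < size s)%N ->
    C1_curve_on `[nth 0 (q :: s) i, nth 0 s i]%classic gamma by exact: (C1 i.+1).
have [gq|gq] := pselect (chart_ball l (gamma q)); last first.
  have [k [mk k0 kz ks kl]] := IH q l qs ls q0 C1s lr gq.
  exists k; split=> //.
    by move=> h ph; apply: kz; apply: contra ph => /andP[qh ->]; rewrite (lt_trans pq).
  move=> h ph; have [qh|hq] := boolP (q < h < 1); first exact: ks.
  by rewrite kz//; exact: sqrtr_ge0.
(* The ball is open, so [gamma q], at radius exactly [m], lies outside the ball of radius [m] and
   the induction hypothesis applies. *)
have [cq ql] := gq; set m := `|_| in ql.
have gq' : ~ chart_ball m (gamma q) by move=> [_]; rewrite ltxx.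
have [k2 [mk2 k20 kz2 ks2 kl2]] := IH q m qs ls q0 C1s (ltW (lt_le_trans ql lr)) gq'.
have [k1 [mk1 k10 kz1 ks1 kl1]] :=
  piece_lower_bound pq p0 q1 (C1 0%N isT) lr gp cq (erefl m) ql.
exists (k1 \+ k2); split.
- exact: measurable_funD.
- by move=> h /=; rewrite addr_ge0.
- move=> h ph /=; rewrite kz1 ?kz2 ?addr0//.
    by apply: contra ph => /andP[qh ->]; rewrite (lt_trans pq).
  by apply: contra ph => /andP[-> hq]; rewrite (lt_le_trans hq).
- move=> h /andP[ph h1] /=; have [hq|qh|hq] := ltgtP h q.
  + rewrite [k2 h]kz2; first by rewrite addr0 ks1// ph.
    by rewrite negb_and -leNgt ltW.
  + rewrite [k1 h]kz1; first by rewrite add0r ks2// qh.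
    by rewrite negb_and -!leNgt (ltW qh) orbT.
  + rewrite kz1 ?kz2 ?addr0 ?sqrtr_ge0// hq ltxx// andbF//.
- under eq_integral do rewrite EFinD.
  rewrite ge0_integralD//.
  + have -> : Num.sqrt lam * l = Num.sqrt lam * (l - m) + Num.sqrt lam * m.
      by rewrite -mulrDr subrK.
    by rewrite EFinD leeD.
  + by move=> h _; rewrite lee_fin.
  + exact/measurable_EFinP.
  + by move=> h _; rewrite lee_fin.
  + exact/measurable_EFinP.
Qed.

Lemma curve_length_lower_bound gamma : piecewise_C1 gamma -> gamma 1 = x0 ->
  ~ chart_ball rho (gamma 0) -> ((Num.sqrt lam * rho)%:E <= curve_length gamma)%E.
Proof.
move=> [s [ps ls C1]] g1 g0.
have [k [mk k0 kz ks kl]] := path_lower_bound ps ls (lexx 0) C1 g1 (lexx rho) g0.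
apply: (le_trans kl); rewrite /curve_length [leRHS]integral_mkcond.
apply: ge0_le_integral_setT => h; first by rewrite lee_fin.
rewrite patchE; case: ifPn; rewrite ?inE ?notin_setE /= in_itv /= => hI.
  rewrite lee_fin; have [hI'|hI'] := boolP (0 < h < 1); first exact: ks.
  by rewrite kz//; exact: sqrtr_ge0.
rewrite kz//; apply/negP => /andP[h0 h1]; apply: hI.
by rewrite !ltW.
Qed.

End LengthLowerBound.

Section DistanceTopology.
Context {R : realType} {n : nat} {M : riemannian R n}.

(** A curve shorter than [Num.sqrt lam * rho] that ends at [x0] must start in the chart ball of
    radius [rho], which is chosen so that [U] contains it. *)
Lemma rdist_small_near (x0 : M) (U : set M) : nbhs x0 U ->
  exists2 r : R, 0 < r & forall x, (rdist x x0 <= r%:E)%E -> U x.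
Proof.
move=> xU; pose c := chart_at x0; have Ac := chart_at_atlas x0 : atlas c.
have cx0 : cdom c x0 := chart_at_dom x0.
have [lam lam0 Hlam] := near_metric_lower_bound Ac cx0.
have HU : \forall y \near cfun c x0, U (cinv c y).
  by apply: (cinv_cvg (cimg_cfun cx0)); rewrite cfunK.
have H : \forall y \near cfun c x0, cimg c y /\ U (cinv c y) /\
    forall v : 'rV[R]_n, lam * `|v| ^+ 2 <= (v *m gmx c y *m v^T) 0 0.
  by apply: filterI; [exact: near_cimg (cimg_cfun cx0)|apply: filterI].
case/nbhs_ballP: H => r /= r0 H.
pose rho := r / 2.
have rho0 : 0 < rho by rewrite divr_gt0.
have rhor : rho < r by rewrite ltr_pdivrMr// ltr_pMr// ltr1n.
have rhoP y : `|y - cfun c x0| <= rho -> cimg c y /\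
    forall v : 'rV[R]_n, lam * `|v| ^+ 2 <= (v *m gmx c y *m v^T) 0 0.
  move=> yr; have [|? [? ?]//] := H y.
  by rewrite -ball_normE /= distrC (le_lt_trans yr).
have sr0 : 0 < Num.sqrt lam * rho by rewrite mulr_gt0// sqrtr_gt0.
(* Halving turns the non-strict bound on the distance into a strict one, which yields a curve
   shorter than [Num.sqrt lam * rho]. *)
exists (Num.sqrt lam * rho / 2); first by rewrite divr_gt0.
move=> x xr.
have : (rdist x x0 < (Num.sqrt lam * rho)%:E)%E.
  by rewrite (le_lt_trans xr)// lte_fin ltr_pdivrMr// ltr_pMr// ltr1n.
move=> /ereal_inf_lt[_ [gamma [gC g0 g1] <-]] gl.
have [[cx xl]|nb] := pselect (chart_ball c x0 rho (gamma 0)); last first.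
  have := curve_length_lower_bound Ac cx0 lam0 rhoP gC g1 nb.
  by rewrite leNgt gl.
rewrite g0 in cx xl.
have [|_ [+ _]] := H (cfun c x); last by rewrite cfunK.
by rewrite -ball_normE /= distrC (lt_trans xl).
Qed.

End DistanceTopology.

(** * Straight segments in a chart and the upper bound for the distance *)

Section ChartSegments.
Context {R : realType} {n : nat} {M : riemannian R n}.
Variables (c : chart R n M) (y v : 'rV[R]_n).
Hypothesis Ac : atlas c.

Let L (h : R) : 'rV[R]_n := y + h *: v.
Definition chart_segment (h : R) : M := cinv c (y + h *: v).

Hypothesis seg : forall h : R, 0 <= h <= 1 -> cimg c (y + h *: v).

Let Lcvg (h : R) : L h' @[h' --> h] --> L h.
Proof. by apply: cvgD; [exact: cvg_cst|apply: cvgZr_tmp; exact: cvg_id]. Qed.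

Let itv01 (h : R) : `[0, 1]%classic h -> 0 <= h <= 1.
Proof. by rewrite /= in_itv. Qed.

Let near_seg (h : R) : 0 <= h <= 1 -> \forall h' \near h, cimg c (L h').
Proof. by move=> h01; apply: Lcvg; apply: near_cimg; exact: seg. Qed.

Lemma chart_segment_cvg (h : R) : 0 <= h <= 1 ->
  chart_segment h' @[h' --> h] --> chart_segment h.
Proof.
move=> h01; apply: (@cvg_comp _ _ _ L (cinv c) _ (nbhs (L h)) _ (@Lcvg h)).
exact: cinv_cvg (seg h01).
Qed.

Lemma chart_segment_dom h : 0 <= h <= 1 -> cdom c (chart_segment h).
Proof. by move=> h01; exact: cinv_dom (seg h01). Qed.

Lemma cfun_chart_segment h : 0 <= h <= 1 -> cfun c (chart_segment h) = L h.
Proof. by move=> h01; rewrite cinvK//; exact: seg. Qed.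

Let chart_derive b (h : R) : atlas b -> 0 <= h <= 1 -> cdom b (chart_segment h) ->
  is_derive h 1 (cfun b \o chart_segment) ('D_v (cfun b \o cinv c) (L h)).
Proof.
move=> Ab h01 bh; apply: is_derive_line; apply: diff_derivable.
have := transition_map_differentiable Ac Ab (chart_segment_dom h01) bh.
by rewrite cfun_chart_segment.
Qed.

Let chart_derive_in b (h : R) : atlas b -> 0 <= h <= 1 -> cdom b (chart_segment h) ->
  (h' - h)^-1 *: ((cfun b \o chart_segment) h' - (cfun b \o chart_segment) h)
    @[h' --> within `[0, 1]%classic h^'] --> 'D_v (cfun b \o cinv c) (L h).
Proof.
move=> Ab h01 bh; apply: cvg_within_filter.
exact: is_derive_cvg_quotient (chart_derive Ab h01 bh).
Qed.

Let derive_inE b (h : R) : atlas b -> 0 <= h <= 1 -> cdom b (chart_segment h) ->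
  derive_in `[0, 1]%classic (cfun b \o chart_segment) h =
  \row_k \sum_i v 0 i * partial i (coord (cfun b \o cinv c) k) (L h).
Proof.
move=> Ab h01 bh.
have PF : ProperFilter (within `[0, 1]%classic h^').
  by apply: within_itv_proper; rewrite ?ltr01// in_itv.
rewrite [LHS](cvg_lim _ (chart_derive_in Ab h01 bh))//.
have dt := transition_map_differentiable Ac Ab (chart_segment_dom h01) bh.
rewrite cfun_chart_segment// in dt.
apply/rowP => k; rewrite mxE derive_mx; last exact: diff_derivable.
rewrite mxE -diff_row; last exact: differentiable_coordP.
by rewrite -deriveE//; exact: differentiable_coordP.
Qed.

(** [C1_curve_on] quantifies over all charts of the atlas. In a chart [b] the velocity is expressed
    by the partials of the transition map from [c], and their continuity gives that of the
    velocity. *)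
Lemma chart_segment_C1 : piecewise_C1 chart_segment.
Proof.
exists [:: 1]; split => //=; first by rewrite ltr01.
move=> [|//] _ /=; split.
  apply/subspace_continuousP => h /itv01 h01.
  by apply: cvg_within_filter; exact: chart_segment_cvg.
move=> b Ab; split.
  move=> h /itv01 h01 bh; apply/cvg_ex; eexists.
  exact: chart_derive_in.
apply/subspace_continuousP => h [/itv01 h01 /= bh].
have H : (fun h' => \row_k \sum_i v 0 i * partial i (coord (cfun b \o cinv c) k) (L h'))
    @ h --> derive_in `[0, 1]%classic (cfun b \o chart_segment) h.
  rewrite derive_inE//; apply: (@cvg_mx R _ (nbhs h)) => i0 k.
  under eq_fun do rewrite mxE; rewrite mxE.
  apply: (@cvg_sumr R _ (nbhs h)) => i.
  apply: (@cvgM _ _ _ _ (cst (v 0 i))); first exact: cvg_cst.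
  apply: (@cvg_comp _ _ _ L (partial i (coord (cfun b \o cinv c) k)) _ (nbhs (L h)) _ (@Lcvg h)).
  have [_ /(_ i) dp] := transition_map_diff2 k Ac Ab (chart_segment_dom h01) bh.
  by rewrite cfun_chart_segment// in dp; exact: differentiable_continuous.
apply: cvg_trans _ (@cvg_within_filter _ _ _ _ _ _
  (`[0, 1] `&` chart_segment @^-1` cdom b) H).
by apply: fmap_within_eq => h' /[!inE] -[/itv01 h'01 bh']; rewrite -derive_inE.
Qed.

Lemma chart_segment_speed (h : R) : 0 <= h <= 1 ->
  speed chart_segment h = Num.sqrt ((v *m gmx c (L h) *m v^T) 0 0).
Proof.
move=> h01; have ch := chart_segment_dom h01.
have gs : chart_segment h' @[h' --> within `[0, 1]%classic h^'] --> chart_segment h.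
  apply: cvg_within_filter; apply: cvg_trans (chart_segment_cvg h01).
  by apply: cvg_app; exact: cvg_within.
have Lh : is_derive h 1 L v.
  have := @is_derive_line _ _ _ id y v h (@derivable_id _ _ _ _).
  by rewrite derive_id.
have ce : is_derive h 1 (cfun c \o chart_segment) v.
  apply: near_eq_is_derive Lh.
  by apply: filterS (near_seg h01) => h' ch'; rewrite /= /chart_segment cinvK.
have vs : (h' - h)^-1 *: (cfun c (chart_segment h') - cfun c (chart_segment h))
    @[h' --> within `[0, 1]%classic h^'] --> v.
  by apply: cvg_within_filter; exact: is_derive_cvg_quotient ce.
by rewrite (speed_in_chart Ac h01 ch gs vs) cfun_chart_segment.
Qed.

Lemma chart_segment_length (K : R) : 0 <= K ->
  (forall h, 0 <= h <= 1 -> (v *m gmx c (L h) *m v^T) 0 0 <= K ^+ 2) ->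
  (curve_length chart_segment <= K%:E)%E.
Proof.
move=> K0 HK; rewrite /curve_length integral_mkcond.
have -> : K%:E = (\int[lebesgue_measure]_(s in `[0%R, 1%R]) cst K%:E s)%E.
  rewrite integral_cst//= lebesgue_measure_itv /= lte_fin ltr01.
  by rewrite oppr0 adde0 mule1.
rewrite [leRHS]integral_mkcond.
apply: ge0_le_integral_setT => h; rewrite !patchE; case: ifPn => //.
  by move=> _; rewrite lee_fin; exact: sqrtr_ge0.
rewrite inE => /itv01 h01; rewrite lee_fin chart_segment_speed//.
by rewrite (le_trans (ler_wsqrtr (HK h h01)))// sqrtr_sqr ger0_norm.
Qed.

End ChartSegments.

Section DistanceUpperBound.
Context {R : realType} {n : nat} {M : riemannian R n}.

Lemma near_rdist_lt (x0 : M) (k : R) : 0 < k ->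
  \forall x \near x0, (rdist x x0 < k%:E)%E.
Proof.
move=> k0; pose c := chart_at x0; have Ac := chart_at_atlas x0 : atlas c.
have cx0 : cdom c x0 := chart_at_dom x0.
have [C C0 HC] := near_metric_upper_bound Ac cx0.
have H : \forall y \near cfun c x0, cimg c y /\
    forall v : 'rV[R]_n, (v *m gmx c y *m v^T) 0 0 <= C * `|v| ^+ 2.
  by apply: filterI; [exact: near_cimg (cimg_cfun cx0)|].
case/nbhs_ballP: H => r /= r0 H.
(* [r] keeps the segment where the metric is bounded by [C]; the other entry makes its length, at
   most [Num.sqrt C * |v|], smaller than [k]. *)
pose d := Num.min r (k / Num.sqrt C).
have sC : 0 < Num.sqrt C by rewrite sqrtr_gt0.
have d0 : 0 < d by rewrite lt_min r0 divr_gt0.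
have /cvgrPdist_lt /(_ d d0) Hd := cfun_cvg cx0.
apply: filterS2 (near_cdom cx0) Hd => x cx xd.
pose y := cfun c x; pose v := cfun c x0 - y.
have nv : `|v| < d by [].
have inb (h : R) : 0 <= h <= 1 -> ball (cfun c x0) r (y + h *: v).
  move=> /andP[h0 h1]; rewrite -ball_normE /= opprD addrA -/v.
  rewrite -[X in X - _]scale1r -scalerBl normrZ ger0_norm ?subr_ge0//.
  apply: (@le_lt_trans _ _ `|v|); first by rewrite ler_piMl// gerBl.
  by rewrite (lt_le_trans nv)// ge_min lexx.
have seg (h : R) : 0 <= h <= 1 -> cimg c (y + h *: v) by move=> /inb/H[].
have lenb : (curve_length (chart_segment c y v) <= (Num.sqrt C * `|v|)%:E)%E.
  apply: chart_segment_length => //.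
  move=> h /inb/H[_ Hv]; apply: le_trans (Hv v) _.
  by rewrite exprMn sqr_sqrtr//; exact: ltW.
apply: (@le_lt_trans _ _ (curve_length (chart_segment c y v))).
  apply: ereal_inf_lbound; exists (chart_segment c y v) => //; split.
  - exact: chart_segment_C1.
  - by rewrite /chart_segment scale0r addr0 /y cfunK.
  - by rewrite /chart_segment scale1r /v addrC subrK cfunK.
apply: le_lt_trans lenb _; rewrite lte_fin mulrC -ltr_pdivlMr//.
by rewrite (lt_le_trans nv)// ge_min lexx orbT.
Qed.

End DistanceUpperBound.

(** * The lower semicontinuous envelope *)

Section LscEnvelope.
Context {R : realType} {n : nat} {M : riemannian R n}.
Variables (T : R) (Omega : set M) (u : R * M -> R).

Definition inf_near (z : R * M) (r : R) : \bar R :=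
  ereal_inf [set (u w)%:E | w in [set w | [/\ cylinder T Omega w,
    `|w.1 - z.1| <= r & (rdist w.2 z.2 <= r%:E)%E]]].

Lemma inf_near_le z (r r' : R) : r <= r' -> (inf_near z r' <= inf_near z r)%E.
Proof.
move=> rr'; apply: ereal_inf_le_tmp => _ [w [cw w1 w2] <-].
exists w => //; split=> //; first exact: le_trans rr'.
by rewrite (le_trans w2)// lee_fin.
Qed.

(** The infima increase as the radius shrinks, so the limit exists as a supremum. *)
Lemma lsc_env_sup z :
  lsc_env T Omega u z = ereal_sup [set inf_near z r | r in [set` `]0, +oo[ ]].
Proof.
apply: cvg_lim => //; apply: (@nonincreasing_at_right_cvge R (inf_near z) 0 +oo%O) => //.
by move=> r r' _ _; exact: inf_near_le.
Qed.

(** The point itself competes in every infimum; [near_rdist_lt] at the centre bounds [rdist z.2 z.2]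
    by every positive radius. *)
Lemma lsc_env_le z : cylinder T Omega z -> (lsc_env T Omega u z <= (u z)%:E)%E.
Proof.
move=> cz; rewrite lsc_env_sup; apply: ge_ereal_sup => _ [r /= + <-].
rewrite in_itv /= andbT => r0.
apply: ereal_inf_lbound; exists z => //; split=> //.
  by rewrite subrr normr0 ltW.
exact/ltW/(nbhs_singleton (near_rdist_lt z.2 r0)).
Qed.

Lemma lsc_env_approx z (l e : R) (U : set (R * M)) :
  lsc_env T Omega u z = l%:E -> 0 < e -> nbhs z U ->
  exists w, [/\ cylinder T Omega w, U w & u w < l + e].
Proof.
move=> zl e0 [[P Q] /= [Pz Qz] PQ].
have [r1 r10 Hr1] := rdist_small_near Qz.
have /nbhs_ballP[r2 /= r20 Hr2] := Pz.
pose r := Num.min r1 (r2 / 2).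
have r0 : 0 < r by rewrite lt_min r10 divr_gt0.
have : (inf_near z r < (l + e)%:E)%E.
  apply: (@le_lt_trans _ _ l%:E); last by rewrite lte_fin ltrDl.
  rewrite -zl lsc_env_sup; apply: ereal_sup_ubound; exists r => //=.
  by rewrite in_itv /= r0.
move=> /ereal_inf_lt[_ [w [cw w1 w2] <-]]; rewrite lte_fin => uw.
exists w; split=> //; apply: PQ; split=> /=.
  apply: Hr2; rewrite -ball_normE /= distrC (le_lt_trans w1)// /r gt_min.
  by rewrite ltr_pdivrMr// ltr_pMr// ltr1n orbT.
apply: Hr1; apply: le_trans w2 _; rewrite lee_fin /r ge_min lexx//.
Qed.

End LscEnvelope.

(** * The bump *)

Section SquaredDistance.
Context {R : realType} {n : nat}.
Variable y0 : 'rV[R]_n.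

(** A sum of squares, because the maximum norm of row vectors is not smooth. *)
Definition sqdist (y : 'rV[R]_n) : R := \sum_i (y 0 i - y0 0 i) ^+ 2.

Let lin i (y : 'rV[R]_n) : R := y 0 i - y0 0 i.

Let linE i : lin i = coord id i + cst (- y0 0 i).
Proof. by apply/funext. Qed.

Let dcoord i y : differentiable (coord id i : 'rV[R]_n -> R) y.
Proof. exact: differentiable_coord. Qed.

Let dlin i y : differentiable (lin i) y.
Proof. by rewrite linE; apply: differentiableD => //; exact: differentiable_cst. Qed.

Let partial_lin i j y : partial j (lin i) y = (i == j)%:R.
Proof.
rewrite linE (partialD _ (dcoord i y) (differentiable_cst _ _)).
rewrite [partial j (cst _) y]derive_cst addr0 partial_coord//.
by rewrite /partial derive_id mxE eqxx.
Qed.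

Let sqdistE : sqdist = \sum_i (lin i * lin i).
Proof. by apply/funext => y; rewrite fct_sumE; apply: eq_bigr => i _; rewrite expr2. Qed.

Lemma sqdist_differentiable y : differentiable sqdist y.
Proof. by rewrite sqdistE; apply: differentiable_sum => i; exact: differentiableM. Qed.

Lemma partial_sqdist j y : partial j sqdist y = 2 * (y 0 j - y0 0 j).
Proof.
rewrite sqdistE partial_sum; last by move=> i; exact: differentiableM.
rewrite (bigD1 j)//= big1 ?addr0 => [|i ij].
  by rewrite partialM// partial_lin eqxx mulr1 -mulr2n mulr_natl.
by rewrite partialM// partial_lin (negbTE ij) mulr0 addr0.
Qed.

Let partial_sqdistE j : partial j sqdist = 2 *: lin j.
Proof. by apply/funext => y; rewrite partial_sqdist. Qed.

Lemma sqdist_diff2 y : diff2 sqdist y.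
Proof.
split; first by near=> z; exact: sqdist_differentiable.
by move=> j; rewrite partial_sqdistE; exact: differentiableZ.
Unshelve. all: by end_near. Qed.

Lemma partial2_sqdist i j y : partial j (partial i sqdist) y = 2 * (i == j)%:R.
Proof.
rewrite partial_sqdistE /partial deriveZ; last exact: diff_derivable.
by rewrite -[X in _ *: X = _]/(partial j (lin i) y) partial_lin.
Qed.

Lemma sqdist0 : sqdist y0 = 0.
Proof. by rewrite /sqdist big1// => i _; rewrite subrr expr0n. Qed.

Lemma sqdist_ge0 y : 0 <= sqdist y.
Proof. by apply: sumr_ge0 => i _; exact: sqr_ge0. Qed.

Lemma sqdist_small y (r : R) : 0 <= r -> sqdist y <= r ^+ 2 -> `|y - y0| <= r.
Proof.
move=> r0 yr; apply: row_norm_le => // i; rewrite !mxE.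
rewrite -(ler_sqr (normr_ge0 _)) ?nnegrE// real_normK ?num_real//.
apply: le_trans yr; rewrite /sqdist (bigD1 i)//= lerDl.
by apply: sumr_ge0 => k _; exact: sqr_ge0.
Qed.

End SquaredDistance.

Section Bump.
Context {R : realType} {n : nat} {M : riemannian R n}.
Variables (T : R) (phi : R * M -> R) (that : R) (xhat : M) (a : chart R n M).
Hypotheses (phiC : C12 T phi) (Aa : atlas a) (ahat : cdom a xhat)
  (that0T : 0 < that < T).
Let y0 := cfun a xhat.

Definition bump_dist (z : R * M) : R := (z.1 - that) ^+ 2 + sqdist y0 (cfun a z.2).

(** [del] is independent of [gam] here, so that smallness of both is a neighbourhood of [(0, 0)]. *)
Definition bump (gam del : R) (z : R * M) : R := phi z + del - gam * bump_dist z.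

Definition bump_tderiv (gam : R) (z : R * M) : R :=
  tderiv T phi z - gam * (2 * (z.1 - that)).

(** The jet in chart [a] is written out explicitly: [cfun a] is arbitrary off its domain, so [bump]
    need not be [C12] on the whole of [M]. *)
Definition bump_grad (gam : R) (z : R * M) : 'cV[R]_n :=
  \col_i (xpartial i (in_chart a phi) (z.1, cfun a z.2)
    - gam * (2 * (cfun a z.2 0 i - y0 0 i))).

Definition bump_hess (gam : R) (z : R * M) : 'M[R]_n :=
  \matrix_(i, j) (xpartial j (xpartial i (in_chart a phi)) (z.1, cfun a z.2)
    - gam * (2 * (i == j)%:R)
    - \sum_k christoffel_of (gmx a) k i j (cfun a z.2) * bump_grad gam z k 0).

Lemma bump_dist_cvg t x : cdom a x -> bump_dist z @[z --> (t, x)] --> bump_dist (t, x).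
Proof.
move=> ax; apply: (@cvgD _ _ _ (nbhs (t, x))).
  apply: (@cvg_comp _ _ _ (fun z : R * M => z.1) (fun s => (s - that) ^+ 2) _ (nbhs t)).
    exact: cvg_fst.
  apply: (@continuous_comp _ _ _ (fun s => s - that) (fun s => s ^+ 2)); last exact: exprn_continuous.
  by apply: cvgB; [exact: cvg_id|exact: cvg_cst].
apply: (@cvg_comp _ _ _ (fun z : R * M => cfun a z.2) (sqdist y0) _ (nbhs (cfun a x))).
  apply: (@cvg_comp _ _ _ (fun z : R * M => z.2) (cfun a) _ (nbhs x)).
    exact: cvg_snd.
  exact: cfun_cvg.
by apply: differentiable_continuous; exact: sqdist_differentiable.
Qed.

Lemma bump_cvg gam del t x : 0 < t < T -> cdom a x ->
  bump gam del z @[z --> (t, x)] --> bump gam del (t, x).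
Proof.
move=> tT ax; apply: cvgB.
  by apply: cvgD; [exact: (@C12_cvg _ _ _ _ _ phiC t x tT)|exact: cvg_cst].
by apply: (@cvgM _ _ _ _ (cst gam)); [exact: cvg_cst|exact: bump_dist_cvg].
Qed.

Lemma bump_hess_sym gam t x : 0 < t < T -> cdom a x ->
  (bump_hess gam (t, x))^T = bump_hess gam (t, x).
Proof.
move=> tT ax; apply/matrixP => i j; rewrite [LHS]mxE [LHS]mxE [RHS]mxE /=.
rewrite -[xpartial i (xpartial j _) _]/(partial i (partial j (chart_slice a phi t)) (cfun a x)).
rewrite (partialC j i (C12_diff2 phiC Aa tT (cimg_cfun ax))) eq_sym.
congr (_ - _); apply: eq_bigr => k _; rewrite christoffel_ofC// => z.
exact: gmx_sym.
Qed.

Section Touching.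
Variables (psi : R * M -> R) (gam del t : R) (x : M).
Hypotheses (psiC : C12 T psi) (tT : 0 < t < T) (ax : cdom a x).
Hypotheses (above : \forall z \near (t, x), bump gam del z <= psi z)
  (touch : bump gam del (t, x) = psi (t, x)).

(** At fixed [x], [psi] minus the bump is [g] up to a constant, and [t] is an interior minimum of
    it, so the two-sided derivative vanishes. *)
Lemma touching_tderiv : tderiv T psi (t, x) = bump_tderiv gam (t, x).
Proof.
pose g s := psi (s, x) - phi (s, x) + gam * (s - that) ^+ 2.
pose dg s := tderiv T psi (s, x) - tderiv T phi (s, x) + gam * (2 * (s - that)).
have dgE s : 0 < s < T -> is_derive s 1 g (dg s).
  move=> /andP[s0 sT].
  have sD : nbhs s `[0, T]%classic.
    have : \forall h \near s, h \in `]0, T[ by apply: near_in_itvoo; rewrite in_itv /= s0.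
    by apply: filterS => h; rewrite /= !in_itv /= => /andP[/ltW -> /ltW].
  have sI : (`[0, T] `*` [set: M]) (s, x) by split=> //=; rewrite in_itv /= !ltW.
  have d1 : is_derive s 1 (fun s => psi (s, x)) (tderiv T psi (s, x)).
    by apply: derivable_in_is_derive => //; have [_ + _ _] := psiC => /(_ _ sI).
  have d2 : is_derive s 1 (fun s => phi (s, x)) (tderiv T phi (s, x)).
    by apply: derivable_in_is_derive => //; have [_ + _ _] := phiC => /(_ _ sI).
  have d3 : is_derive s 1 (fun s => gam * (s - that) ^+ 2) (gam * (2 * (s - that))).
    have d0 : is_derive s 1 (fun h : R => h - that) 1.
      have := is_deriveB (is_derive_id s 1) (is_derive_cst that s 1).
      by rewrite subr0.
    have K := is_deriveZ gam (is_deriveM d0 d0).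
    have -> : (fun h : R => gam * (h - that) ^+ 2) =
        gam \*: ((fun h : R => h - that) * (fun h : R => h - that)).
      by apply/funext => h; rewrite expr2.
    apply: is_derive_eq K _.
    by rewrite /GRing.scale /= !mulr1 -mulr2n mulr_natl.
  exact: is_deriveD.
have gmin : \forall s \near t, g t <= g s.
  apply: filterS (near_section1 above) => s; move: touch; rewrite /bump /bump_dist /g /= !mulrDr.
  have K (pt ps ft fs q qt qs d : R) : ft + d - (qt + q) = pt ->
      fs + d - (qs + q) <= ps -> pt - ft + qt <= ps - fs + qs by move=> *; lra.
  exact: K.
have H1 : \forall s \near t, 0 < s < T /\ g t <= g s.
  by apply: filterI => //; exact: near_time.
have /nbhs_ballP[r /= r0 H] := H1.
have sub (s : R) : s \in `]t - r, t + r[%R -> ball t r s.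
  by rewrite in_itv /= -ball_normE /= => /andP[s1 s2]; rewrite ltr_norml; lra.
have rr : t - r <= t + r by lra.
have [||s /sub/H[]//|_ gE] := @derive1_at_min _ g _ _ t rr.
- by move=> s /sub/H[/dgE[]].
- by rewrite in_itv /= ltrBlDr !ltrDl r0.
have [_] := dgE t tT; rewrite gE /bump_tderiv /dg /= => E.
by move: E; move: (tderiv _ _ _) (tderiv _ _ _) (gam * _) => *; lra.
Qed.

Let f := chart_slice a psi t - chart_slice a phi t + gam *: sqdist y0.

Let fC : diff2 f (cfun a x).
Proof.
have ix := cimg_cfun ax.
apply: diff2D; last by apply: diff2Z; exact: sqdist_diff2.
apply: diff2D; first exact: (C12_diff2 psiC Aa tT ix).
by apply: diff2N; exact: (C12_diff2 phiC Aa tT ix).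
Qed.

Let fmin : \forall y \near cfun a x, f (cfun a x) <= f y.
Proof.
have H : \forall y \near cfun a x, bump gam del (t, cinv a y) <= psi (t, cinv a y).
  have nb : nbhs (cinv a (cfun a x)) (fun x' => bump gam del (t, x') <= psi (t, x')).
    by rewrite cfunK//; exact: near_section2 above.
  exact: (cinv_cvg (cimg_cfun ax) nb).
apply: filterS2 (near_cimg (cimg_cfun ax)) H => y ay.
have fE z : f z = psi (t, cinv a z) - phi (t, cinv a z) + gam * sqdist y0 z by [].
rewrite !fE cfunK//; move: touch; rewrite /bump /bump_dist /= cinvK// !mulrDr.
move: (gam * sqdist _ _) (gam * sqdist _ _) (gam * _) (psi _) (psi _) (phi _) (phi _) => *; lra.
Qed.

Lemma touching_gradient : gradient (chart_slice a psi t) (cfun a x) =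
  bump_grad gam (t, x).
Proof.
have ix := cimg_cfun ax.
have dpsi := nbhs_singleton (C12_diff2 psiC Aa tT ix).1.
have dphi := nbhs_singleton (C12_diff2 phiC Aa tT ix).1.
have dsq := sqdist_differentiable y0 (cfun a x).
apply/colP => i; rewrite !mxE /=; have := local_min_derive (delta_mx 0 i) fC fmin.
rewrite -[LHS]/(partial i f (cfun a x)) partialD//; last exact: differentiableZ.
  rewrite partialD//; last exact: differentiableN.
  rewrite partialN// partialZ// partial_sqdist.
  rewrite -[xpartial _ _ _]/(partial i (chart_slice a phi t) (cfun a x)).
  by move: (partial _ _ _) (partial _ _ _) (gam * _) => *; lra.
by apply: differentiableB.
Qed.

(** The gradients agree at the touching point, so the Christoffel terms cancel in the difference.
    What remains is the matrix of second partials of [f] at a local minimum. *)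
Lemma touching_hessian (v : 'rV[R]_n) :
  (v *m bump_hess gam (t, x) *m v^T) 0 0 <=
  (v *m covariant_hessian (gmx a) (chart_slice a psi t) (cfun a x) *m v^T) 0 0.
Proof.
have ix := cimg_cfun ax.
have d2psi := C12_diff2 psiC Aa tT ix; have d2phi := C12_diff2 phiC Aa tT ix.
have d2sq := sqdist_diff2 y0 (cfun a x).
rewrite -subr_ge0 -quadratic_formB quadratic_formE exchange_big.
have := local_min_partial2 v fC fmin; congr (_ <= _).
apply: eq_bigr => i _; apply: eq_bigr => j _.
rewrite [RHS]mulrAC; congr (_ * _).
rewrite partial2D//; last 2 first.
- by apply: diff2D => //; exact: diff2N.
- exact: diff2Z.
rewrite partial2D//; last exact: diff2N.
rewrite partial2N// partial2Z// partial2_sqdist.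
rewrite [RHS]mxE [X in _ = X + _]mxE [X in _ = _ + X]mxE [X in _ = _ - X]mxE -touching_gradient.
under [X in _ = _ - (_ - X)]eq_bigr do rewrite mxE.
rewrite -[xpartial j _ _]/(partial j (partial i (chart_slice a phi t)) (cfun a x)).
move: (\sum_k _) (partial _ _ _) (partial _ _ _) (gam * _) => *; ring.
Qed.

End Touching.
End Bump.

(** * Stability of the strict inequality *)

Section StrictBump.
Context {R : realType} {n : nat} {M : riemannian R n}.
Variables (T : R) (F : R -> M -> R -> 'cV[R]_n -> 'M[R]_n -> R).
Variables (phi : R * M -> R) (that : R) (xhat : M) (a : chart R n M).
Hypotheses (phiC : C12 T phi) (Aa : atlas a) (ahat : cdom a xhat)
  (that0T : 0 < that < T) (hF : chi_continuous T F).

Local Notation grad := (bump_grad phi xhat a).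
Local Notation hess := (bump_hess phi xhat a).

(** The point and the two parameters vary together, which makes the choice of parameters uniform
    over a neighbourhood of points. *)
Let near0 : set_system ((R * M) * (R * R)) := nbhs ((that, xhat), (0, 0)).

Let FF : Filter near0 := nbhs_filter _.

Let cvg_z : q.1 @[q --> near0] --> (that, xhat).
Proof. exact: cvg_fst. Qed.

Let cvg_t : q.1.1 @[q --> near0] --> that.
Proof. by apply: (@cvg_comp _ _ _ (fun q : (R * M) * (R * R) => q.1) fst _ _ _ cvg_z); exact: cvg_fst. Qed.

Let cvg_x : q.1.2 @[q --> near0] --> xhat.
Proof. by apply: (@cvg_comp _ _ _ (fun q : (R * M) * (R * R) => q.1) snd _ _ _ cvg_z); exact: cvg_snd. Qed.

Let cvg_gam : q.2.1 @[q --> near0] --> (0 : R).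
Proof.
apply: (@cvg_comp _ _ _ (fun q : (R * M) * (R * R) => q.2) fst near0 (nbhs ((0 : R), (0 : R)))).
  exact: cvg_snd.
exact: cvg_fst.
Qed.

Let cvg_del : q.2.2 @[q --> near0] --> (0 : R).
Proof.
apply: (@cvg_comp _ _ _ (fun q : (R * M) * (R * R) => q.2) snd near0 (nbhs ((0 : R), (0 : R)))).
  exact: cvg_snd.
exact: cvg_snd.
Qed.

Let cvg_y : cfun a q.1.2 @[q --> near0] --> cfun a xhat.
Proof. exact: (@cvg_comp _ _ _ (fun q : (R * M) * (R * R) => q.1.2) (cfun a) _ _ _ cvg_x (cfun_cvg ahat)). Qed.

Let cvg_at_y (f : R * 'rV[R]_n -> R) (l : R) :
  f w @[w --> (that, cfun a xhat)] --> l -> f (q.1.1, cfun a q.1.2) @[q --> near0] --> l.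
Proof.
move=> fl; apply: (@cvg_comp _ _ _ (fun q : (R * M) * (R * R) => (q.1.1, cfun a q.1.2)) f
  near0 (nbhs (that, cfun a xhat))) => //.
exact: cvg_pair cvg_t cvg_y.
Qed.

Let cvg_yi i : cfun a q.1.2 0 i @[q --> near0] --> cfun a xhat 0 i.
Proof.
apply: (@cvg_comp _ _ _ (fun q : (R * M) * (R * R) => cfun a q.1.2)
  (fun N : 'rV[R]_n => N 0 i) _ (nbhs (cfun a xhat))) => //.
exact: coord_continuous.
Qed.

Let cvg_bump : bump phi that xhat a q.2.1 q.2.2 q.1 @[q --> near0] --> phi (that, xhat).
Proof.
have -> : phi (that, xhat) = phi (that, xhat) + 0 - 0 * bump_dist that xhat a (that, xhat).
  by rewrite mul0r subr0 addr0.
apply: cvgB; first apply: cvgD => //.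
  exact: (@cvg_comp _ _ _ (fun q : (R * M) * (R * R) => q.1) phi _ _ _ cvg_z (C12_cvg phiC (x := xhat) that0T)).
apply: cvgM => //.
apply: (@cvg_comp _ _ _ (fun q : (R * M) * (R * R) => q.1) (bump_dist that xhat a)
  _ (nbhs (that, xhat))) => //.
exact: bump_dist_cvg.
Qed.

Let cvg_grad : grad q.2.1 q.1 @[q --> near0] -->
  gradient (chart_slice a phi that) (cfun a xhat).
Proof.
apply: (@cvg_mx R _ _ FF) => i j; rewrite mxE.
under eq_fun do rewrite mxE.
rewrite [partial i _ _](_ : _ = partial i (chart_slice a phi that) (cfun a xhat) -
  0 * (2 * (cfun a xhat 0 i - cfun a xhat 0 i))); last by rewrite mul0r subr0.
apply: cvgB; first exact: (cvg_at_y (C12_partial_cvg (i := i) phiC Aa that0T (cimg_cfun ahat))).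
apply: cvgM => //; apply: (@cvgM _ _ _ _ (cst 2)); first exact: cvg_cst.
by apply: cvgB => //; exact: cvg_cst.
Qed.

Let cvg_hess : hess q.2.1 q.1 @[q --> near0] -->
  covariant_hessian (gmx a) (chart_slice a phi that) (cfun a xhat).
Proof.
apply: (@cvg_mx R _ _ FF) => i j; rewrite mxE.
under eq_fun do rewrite mxE.
rewrite [partial j _ _](_ : _ = partial j (partial i (chart_slice a phi that))
  (cfun a xhat) - 0 * (2 * (i == j)%:R)); last by rewrite mul0r subr0.
apply: cvgB; first apply: cvgB.
- exact: (cvg_at_y (C12_partial2_cvg (i := i) (j := j) phiC Aa that0T (cimg_cfun ahat))).
- by apply: cvgM => //; exact: cvg_cst.
apply: (@cvg_sumr R _ _ FF) => k.
apply: (@cvgM _ _ _ _ (fun q : (R * M) * (R * R) => christoffel_of (gmx a) k i j (cfun a q.1.2))).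
  apply: (@cvg_comp _ _ _ (fun q : (R * M) * (R * R) => cfun a q.1.2)
    (christoffel_of (gmx a) k i j) _ (nbhs (cfun a xhat))) => //.
  exact: christoffel_cvg.
rewrite [partial k _ _](_ : _ = gradient (chart_slice a phi that) (cfun a xhat) k 0); last by rewrite mxE.
apply: (@cvg_comp _ _ _ (fun q : (R * M) * (R * R) => grad q.2.1 q.1)
  (fun N : 'cV[R]_n => N k 0) _ (nbhs (gradient (chart_slice a phi that) (cfun a xhat)))) => //.
exact: coord_continuous.
Qed.

Let hess_sym (q : (R * M) * (R * R)) : 0 < q.1.1 < T -> cdom a q.1.2 ->
  (hess q.2.1 q.1)^T = hess q.2.1 q.1.
Proof. by case: q => [[t x] [g d]]; exact: bump_hess_sym. Qed.

(** The function that [chi_continuous] declares continuous is composed with the jet of the bump in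
    [a], which converges to the jet of [phi] at [(that, xhat)]. *)
Lemma near_strict_bump :
  tderiv T phi (that, xhat) + F that xhat (phi (that, xhat))
    (xdiff phi (that, xhat)) (xhess phi (that, xhat)) < 0 ->
  \forall q \near ((that, xhat), ((0 : R), (0 : R))),
    bump_tderiv T phi that q.2.1 q.1 +
    F q.1.1 q.1.2 (bump phi that xhat a q.2.1 q.2.2 q.1)
      (transition (chart_at q.1.2) a q.1.2 *m grad q.2.1 q.1)
      (transition (chart_at q.1.2) a q.1.2 *m hess q.2.1 q.1 *m
        (transition (chart_at q.1.2) a q.1.2)^T) < 0.
Proof.
rewrite (xdiff_in_chart phiC Aa ahat that0T) (xhess_in_chart phiC Aa ahat that0T) => H.
have /subspace_continuousP G := hF Aa.
have thatT : 0 <= that <= T by case/andP: that0T => /ltW -> /ltW.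
set w0 : R * M * R * 'cV[R]_n * 'M[R]_n :=
  (that, xhat, phi (that, xhat), gradient (chart_slice a phi that) (cfun a xhat),
   covariant_hessian (gmx a) (chart_slice a phi that) (cfun a xhat)).
have symH : (covariant_hessian (gmx a) (chart_slice a phi that) (cfun a xhat))^T =
    covariant_hessian (gmx a) (chart_slice a phi that) (cfun a xhat).
  apply: covariant_hessian_sym; first by move=> z; exact: gmx_sym.
  exact: (C12_diff2 phiC Aa that0T (cimg_cfun ahat)).
have {}G := G w0 (And3 thatT ahat symH).
pose Psi (q : (R * M) * (R * R)) : R * M * R * 'cV[R]_n * 'M[R]_n :=
  (q.1.1, q.1.2, bump phi that xhat a q.2.1 q.2.2 q.1, grad q.2.1 q.1, hess q.2.1 q.1).
have cPsi : Psi q @[q --> near0] --> w0.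
  have c1 : (q.1.1, q.1.2) @[q --> near0] --> (that, xhat) by exact: cvg_pair cvg_t cvg_x.
  have c2 : (q.1.1, q.1.2, bump phi that xhat a q.2.1 q.2.2 q.1) @[q --> near0] -->
    (that, xhat, phi (that, xhat)) by exact: cvg_pair c1 cvg_bump.
  have c3 : (q.1.1, q.1.2, bump phi that xhat a q.2.1 q.2.2 q.1, grad q.2.1 q.1)
      @[q --> near0] --> (that, xhat, phi (that, xhat),
      gradient (chart_slice a phi that) (cfun a xhat)) by exact: cvg_pair c2 cvg_grad.
  exact: cvg_pair c3 cvg_hess.
have ctd : bump_tderiv T phi that q.2.1 q.1 @[q --> near0] --> tderiv T phi (that, xhat).
  rewrite [tderiv _ _ _](_ : _ = tderiv T phi (that, xhat) - 0 * (2 * (that - that))); last first.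
    by rewrite mul0r subr0.
  apply: cvgB.
    exact: (@cvg_comp _ _ _ (fun q : (R * M) * (R * R) => q.1) _ _ _ _ cvg_z (C12_tderiv_cvg phiC (x := xhat) that0T)).
  apply: cvgM => //; apply: (@cvgM _ _ _ _ (cst 2)); first exact: cvg_cst.
  by apply: cvgB => //; exact: cvg_cst.
set Gval := F _ _ _ _ _ in H.
(* Half of the margin: [e] is spent once on the time derivative and once on [F]. *)
pose e := - (tderiv T phi (that, xhat) + Gval) / 2.
have e0 : 0 < e by rewrite divr_gt0// oppr_gt0.
have H1 : \forall q \near near0, bump_tderiv T phi that q.2.1 q.1 < tderiv T phi (that, xhat) + e.
  by apply: (cvgr_lt _ ctd); rewrite ltrDl.
have H2 : \forall q \near near0, 0 <= (Psi q).1.1.1.1 <= T /\ cdom a q.1.2.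
  apply: filterI.
    have tn : \forall t \near that, 0 <= t <= T.
      by apply: filterS (near_time that0T) => t /andP[/ltW -> /ltW].
    exact: cvg_t tn.
  exact: cvg_x (near_cdom ahat).
have H2' : \forall q \near near0, 0 < q.1.1 < T by exact: cvg_t (near_time that0T).
have H3 : \forall q \near near0, 0 <= q.1.1 <= T -> cdom a q.1.2 ->
    (hess q.2.1 q.1)^T = hess q.2.1 q.1 ->
    F q.1.1 q.1.2 (bump phi that xhat a q.2.1 q.2.2 q.1)
      (transition (chart_at q.1.2) a q.1.2 *m grad q.2.1 q.1)
      (transition (chart_at q.1.2) a q.1.2 *m hess q.2.1 q.1 *m
        (transition (chart_at q.1.2) a q.1.2)^T) < Gval + e.
  (* Continuity on chi is relative to symmetric matrices, so the conclusion keeps the symmetry of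
     [hess] as a premise, discharged below by [hess_sym]. *)
  move: G; set D := [set _ | _]; set f := (fun _ => _) => G.
  have Gn : \forall w \near within D (nbhs w0), f w < Gval + e.
    by apply: (cvgr_lt _ G); rewrite ltrDl.
  have H0 : near0 (Psi @^-1` [set w | D w -> f w < Gval + e]) := cPsi _ Gn.
  by apply: filterS H0 => q Hq tT aq sq; exact: (Hq (And3 tT aq sq)).
apply: (@filterS2 _ near0 FF _ _ _ _ (filterI H1 H2) (filterI H2' H3)).
move=> q [h1 [tT aq]] [tT' /(_ tT aq (hess_sym tT' aq)) h3].
have := ltrD h1 h3.
have -> : tderiv T phi (that, xhat) + e + (Gval + e) = 0 by rewrite /e; field.
by [].
Qed.

End StrictBump.

Lemma sym_congruence (R : realType) (n : nat) (P A : 'M[R]_n) :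
  A^T = A -> (P *m A *m P^T)^T = P *m A *m P^T.
Proof. by move=> sA; rewrite !trmx_mul trmxK sA mulmxA. Qed.

(** * The region where the bump is glued in *)

Section BumpSet.
Context {R : realType} {n : nat} {M : riemannian R n}.
Variables (that : R) (xhat : M) (a : chart R n M).
Hypothesis ahat : cdom a xhat.

Definition bump_set (eta : R) : set (R * M) :=
  [set z | cdom a z.2 /\ bump_dist that xhat a z <= eta].

Lemma near_bump_set (U : set (R * M)) : nbhs (that, xhat) U ->
  exists r : R, [/\ 0 < r, forall y, `|y - cfun a xhat| <= r -> cimg a y &
    bump_set (r ^+ 2) `<=` U].
Proof.
move=> [[P V] /= [Pt Vx] PV].
have Vy : \forall y \near cfun a xhat, V (cinv a y).
  have nV : nbhs (cinv a (cfun a xhat)) V by rewrite cfunK.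
  exact: (cinv_cvg (cimg_cfun ahat) nV).
have H : \forall y \near cfun a xhat, cimg a y /\ V (cinv a y).
  by apply: filterI => //; exact: near_cimg (cimg_cfun ahat).
have /nbhs_ballP[r1 /= r10 H1] := H; have /nbhs_ballP[r2 /= r20 H2] := Pt.
pose r := Num.min r1 r2 / 2.
have r0 : 0 < r by rewrite divr_gt0// lt_min r10.
have rm : r < Num.min r1 r2 by rewrite ltr_pdivrMr// ltr_pMr ?ltr1n// lt_min r10.
have [rr1 rr2] : r < r1 /\ r < r2 by move: rm; rewrite lt_min => /andP[].
have inb y : `|y - cfun a xhat| <= r -> ball (cfun a xhat) r1 y.
  by move=> yr; rewrite -ball_normE /= distrC (le_lt_trans yr).
exists r; split=> // [y /inb/H1[]//|[t x] [/= ax Qr]].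
apply: PV; split=> /=.
  apply: H2; rewrite -ball_normE /= distrC (le_lt_trans _ rr2)//.
  rewrite -(ler_sqr (normr_ge0 _)) ?nnegrE ?(ltW r0)// real_normK ?num_real//.
  by apply: le_trans Qr; rewrite /bump_dist lerDl sqdist_ge0.
have /inb/H1[_] : `|cfun a x - cfun a xhat| <= r; last by rewrite cfunK.
apply: sqdist_small; first exact: ltW.
by apply: le_trans Qr; rewrite /bump_dist lerDr sqr_ge0.
Qed.

(** The delicate points are those outside the chart domain, which need not be closed: they are
    separated from the bump set by the closed chart ball of radius [r]. *)
Lemma near_off_bump_set (r eta : R) z : 0 <= r -> eta <= r ^+ 2 ->
  (forall y, `|y - cfun a xhat| <= r -> cimg a y) ->
  ~ bump_set eta z -> \forall w \near z, ~ bump_set eta w.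
Proof.
case: z => t x r0 er Hr nE; have [ax|nax] := pselect (cdom a x).
  have lt : eta < bump_dist that xhat a (t, x).
    by rewrite ltNge; apply/negP => H; exact: nE.
  have H : \forall w \near (t, x), eta < bump_dist that xhat a w.
    by apply: (cvgr_gt _ (bump_dist_cvg (that := that) (xhat := xhat) (t := t) ax)).
  by apply: filterS H => w + [_]; rewrite ltNge => /negP.
have nK : nbhs x (~` chart_cball a xhat r).
  apply: open_nbhs_nbhs; split; last by case.
  by apply: closed_openC; exact: chart_cball_closed.
apply: filterS (near_pair (@filterT _ (nbhs t) _) nK) => w [_ {}nK] [aw Qw].
apply: nK; split=> //; apply: sqdist_small => //.
by apply: le_trans (le_trans Qw er); rewrite /bump_dist lerDr sqr_ge0.
Qed.

Lemma near_bump_set_lt (eta eta' : R) z : eta < eta' -> bump_set eta z ->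
  \forall w \near z, bump_set eta' w.
Proof.
case: z => t x ee [/= ax Q]; have lt := le_lt_trans Q ee.
have H : \forall w \near (t, x), bump_dist that xhat a w < eta'.
  by apply: (cvgr_lt _ (bump_dist_cvg (that := that) (xhat := xhat) (t := t) ax)).
apply: filterS2 (near_pair (@filterT _ (nbhs t) _) (near_cdom ax)) H => w [_ aw] /ltW Qw.
by split.
Qed.

End BumpSet.

Section TouchedBump.
Context {R : realType} {n : nat} {M : riemannian R n}.
Variables (T : R) (F : R -> M -> R -> 'cV[R]_n -> 'M[R]_n -> R).
Variables (phi psi : R * M -> R) (that : R) (xhat : M) (a : chart R n M).
Hypotheses (hFell : degenerate_elliptic T F) (phiC : C12 T phi) (psiC : C12 T psi)
  (Aa : atlas a).

(** Congruence with the transition matrix preserves the order of quadratic forms, so degenerate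
    ellipticity gives a value of [F] at the jet of [psi] no larger than at that of the bump. *)
Lemma touched_bump_lt0 (gam del : R) z : 0 < z.1 < T -> cdom a z.2 ->
  (\forall w \near z, bump phi that xhat a gam del w <= psi w) ->
  bump phi that xhat a gam del z = psi z ->
  bump_tderiv T phi that gam z + F z.1 z.2 (bump phi that xhat a gam del z)
    (transition (chart_at z.2) a z.2 *m bump_grad phi xhat a gam z)
    (transition (chart_at z.2) a z.2 *m bump_hess phi xhat a gam z *m
      (transition (chart_at z.2) a z.2)^T) < 0 ->
  tderiv T psi z + F z.1 z.2 (bump phi that xhat a gam del z)
    (xdiff psi z) (xhess psi z) < 0.
Proof.
case: z => t x /= tT ax above touch; apply: le_lt_trans.
rewrite (touching_tderiv phiC psiC tT above touch) lerD2l.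
rewrite (xdiff_in_chart psiC Aa ax tT) (xhess_in_chart psiC Aa ax tT).
rewrite (touching_gradient phiC Aa psiC tT ax above touch).
set P := transition _ _ _.
have d2 := C12_diff2 psiC Aa tT (cimg_cfun ax).
apply: hFell; first by case/andP: tT => /ltW -> /ltW ->.
- by apply: sym_congruence; exact: (@bump_hess_sym _ _ _ T).
- by apply: sym_congruence; apply: covariant_hessian_sym => // y; exact: gmx_sym.
move=> v; have E N : v *m (P *m N *m P^T) *m v^T = (v *m P) *m N *m (v *m P)^T.
  by rewrite trmx_mul !mulmxA.
by rewrite !E; exact: (touching_hessian phiC Aa psiC tT ax above touch).
Qed.

End TouchedBump.

(** * Gluing the bump to the subsolution *)

Theorem proposition4p4 (R : realType) (n : nat) (M : riemannian R n)
    (Omega : set M) (T : R)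
    (F : R -> M -> R -> 'cV[R]_n -> 'M[R]_n -> R)
    (u : R * M -> R) (that : R) (xhat : M)
    (hOmega : open Omega) (hT : 0 < T)
    (hF : chi_continuous T F)
    (hFell : degenerate_elliptic T F)
    (hu : is_subsolution T Omega F u)
    (hhat : cylinder T Omega (that, xhat))
    (hfail : exists (p : R) (zeta : 'cV[R]_n) (A : 'M[R]_n),
        subjet T Omega (lsc_env T Omega u) (that, xhat) (p, zeta, A) /\
        p + F that xhat (fine (lsc_env T Omega u (that, xhat))) zeta A < 0) :
  exists2 kappa0 : R, 0 < kappa0 &
    forall kappa : R, 0 < kappa -> kappa < kappa0 ->
    exists ukappa : R * M -> R,
      [/\ is_subsolution T Omega F ukappa,
          forall z, cylinder T Omega z -> u z <= ukappa z,
          (0 < ereal_sup [set (ukappa z - u z)%:E | z in cylinder T Omega])%E &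
          forall z, cylinder T Omega z ->
            (kappa%:E <= `|z.1 - that|%:E + rdist z.2 xhat)%E ->
            ukappa z = u z].
Proof.
case: hfail => p [zeta [A [[phi [phiC phi_below phi_touch [pE zE AE]]] Fneg]]].
have cyl_near (z : R * M) : cylinder T Omega z -> nbhs z (cylinder T Omega).
  case: z => t x [tT xO]; rewrite /= in_itv /= in tT.
  apply: filterS (near_pair (near_time tT) (open_nbhs_nbhs (conj hOmega xO))).
  by move=> w [wT wO]; split=> //=; rewrite in_itv.
have cyl_time (z : R * M) : cylinder T Omega z -> 0 < z.1 < T.
  by case=> + _; rewrite /= in_itv.
have that0T := cyl_time _ hhat; rewrite /= in that0T.
pose a := chart_at xhat; have Aa : atlas a := chart_at_atlas xhat.
have ahat : cdom a xhat := chart_at_dom xhat.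
(* A difference equal to 0 rules out infinite values of the envelope. *)
have envE : lsc_env T Omega u (that, xhat) = (phi (that, xhat))%:E.
  move: phi_touch; case: (lsc_env T Omega u (that, xhat)) => [r| |] //.
  by rewrite -EFinB => -[] /eqP; rewrite subr_eq0 => /eqP ->.
have strict := near_strict_bump phiC Aa ahat that0T hF.
rewrite envE /= pE zE AE in Fneg; have {}strict := strict Fneg.
have phi_le_u : \forall z \near (that, xhat), cylinder T Omega z /\ phi z <= u z.
  have H : \forall z \near (that, xhat), cylinder T Omega z ->
    (0 <= lsc_env T Omega u z - (phi z)%:E)%E := phi_below.
  apply: filterS2 (cyl_near _ hhat) H => z cz /(_ cz) H; split=> //.
  rewrite -lee_fin; apply: le_trans (lsc_env_le u cz).
  by move: H; rewrite sube_ge0//.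
exists 1 => // kappa k0 _.
(* The product form of the neighbourhood decouples the choices: [Z] determines [r] and [eta], then
   [W] determines [gam]. *)
case: strict => -[Z W] /= [ZN WN] ZW.
have dist_small : \forall z \near (that, xhat),
    (`|z.1 - that|%:E + rdist z.2 xhat < kappa%:E)%E.
  have k2 : 0 < kappa / 2 by rewrite divr_gt0.
  have tn : \forall t \near that, `|t - that| < kappa / 2.
    by apply/nbhs_ballP; exists (kappa / 2) => // t; rewrite -ball_normE /= distrC.
  apply: filterS (near_pair tn (near_rdist_lt xhat k2)) => z [z1 z2].
  rewrite [kappa]splitr EFinD.
  by apply: lteD => //; rewrite lte_fin.
pose Q := bump_dist that xhat a.
have [r [r0 Hr Er]] := near_bump_set ahat (filterI ZN (filterI dist_small phi_le_u)).
pose eta := r ^+ 2 / 2.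
have r20 : 0 < r ^+ 2 by rewrite exprn_gt0.
have eta0 : 0 < eta by rewrite divr_gt0.
have etar : eta < r ^+ 2 by rewrite ltr_pdivrMr// ltr_pMr// ltr1n.
(* The pair [(g, g * eta)] tends to [(0, 0)] with [g], as [eta] is already fixed. *)
have [gam [gam0 Wgam]] : exists gam : R, 0 < gam /\ W (gam, gam * eta).
  have cW : (g, g * eta) @[g --> (0 : R)^'+] --> ((0 : R), (0 : R)).
    have c1 : g @[g --> (0 : R)^'+] --> (0 : R) by exact: cvg_within.
    have c2 : g * eta @[g --> (0 : R)^'+] --> (0 : R).
      by rewrite -[X in _ --> X](mul0r eta); apply: cvgM => //; exact: cvg_cst.
    exact: cvg_pair c1 c2.
  have H : \forall g \near (0 : R)^'+, 0 < g /\ W (g, g * eta).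
    by apply: filterI; [exact: nbhs_right_gt|exact: cW].
  have [g [g0 Wg]] := filter_ex H.
  by exists g.
pose del := gam * eta; have del0 : 0 < del by rewrite mulr_gt0.
pose w := bump phi that xhat a gam del.
pose E := bump_set that xhat a eta.
have EE : E `<=` bump_set that xhat a (r ^+ 2).
  by move=> z [az Qz]; split=> //; rewrite (le_trans Qz)// ltW.
pose uk z := if `[< E z >] then Num.max (u z) (w z) else u z.
have ukE z : E z -> uk z = Num.max (u z) (w z) by move=> Ez; rewrite /uk asboolT.
have ukN z : ~ E z -> uk z = u z by move=> Ez; rewrite /uk asboolF.
(* In the shell [eta < Q <= r ^+ 2] the bump is at most [phi], hence at most [u], and the maximum is
   [u] again. The formula thus extends past the boundary of [E]. *)
have ukr z : bump_set that xhat a (r ^+ 2) z -> uk z = Num.max (u z) (w z).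
  move=> Ez; have [/ukE//|nE] := pselect (E z).
  rewrite ukN// max_l//; have [_ [_ [_ le]]] := Er _ Ez; apply: le_trans le.
  rewrite /w /bump -addrA gerDl -mulrBr pmulr_rle0// subr_le0 leNgt.
  by apply/negP => /ltW H; apply: nE; split=> //; case: Ez.
have u_le z : u z <= uk z.
  by have [/ukE ->|/ukN ->//] := pselect (E z); rewrite le_max lexx.
have near_ukE z : E z -> \forall y \near z, uk y = Num.max (u y) (w y).
  move=> Ez; have := near_bump_set_lt etar Ez.
  by apply: filterS => y /ukr.
have near_ukN z : ~ E z -> \forall y \near z, uk y = u y.
  move=> nE; have := near_off_bump_set (ltW r0) (ltW etar) Hr nE.
  by apply: filterS => y /ukN.
have ucvg z : E z -> w y @[y --> z] --> w z.
  move=> Ez; have [_ [_ [/cyl_time + _]]] := Er _ (EE _ Ez); case: Ez.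
  case: z => t x /= ax _ tT.
  exact: (@bump_cvg R n M T phi that xhat a phiC gam del t x tT ax).
exists uk; split.
- split=> [z cz b zb|z cz p' zeta' A' [psi [psiC above touch [-> -> ->]]]].
    have ub : forall c, u z < c -> \forall y \near z, cylinder T Omega y -> u y < c.
      by move=> c; exact: hu.1.
    suff: \forall y \near z, cylinder T Omega y -> uk y < b by [].
    have [Ez|nE] := pselect (E z); last first.
      rewrite ukN// in zb.
      by apply: filterS2 (near_ukN _ nE) (ub _ zb) => y ->.
    move: zb; rewrite ukE// gt_max => /andP[uz wz].
    have wn : \forall y \near z, w y < b by apply: (cvgr_lt _ (ucvg _ Ez)).
    apply: filterS3 (near_ukE _ Ez) (ub _ uz) wn => y -> H wy cy.
    by rewrite gt_max H.
  have psiz : uk z = psi z.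
    by move: touch; rewrite /= -EFinB => -[] /eqP; rewrite subr_eq0 => /eqP.
  have {}above : \forall y \near z, uk y <= psi y.
    have H : \forall y \near z, cylinder T Omega y ->
      ((EFin \o uk) y - (psi y)%:E <= 0)%E := above.
    apply: filterS2 (cyl_near _ cz) H => y cy /(_ cy) /=.
    by rewrite -EFinB lee_fin subr_le0.
  (* Where [uk] equals [u], the function [psi] also touches the smaller function [u] from above and
     its subsolution property applies; elsewhere [psi] touches the bump at a point of [E]. *)
  have [uz|uz] := eqVneq (uk z) (u z).
    rewrite uz; apply: (hu.2 z cz); exists psi; split=> //.
      suff: \forall y \near z, cylinder T Omega y ->
        ((EFin \o u) y - (psi y)%:E <= 0)%E by [].
      apply: filterS above => y H _.
      by rewrite /= -EFinB lee_fin subr_le0 (le_trans (u_le y)).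
    by rewrite /= -uz psiz -EFinB subrr.
  have Ez : E z by apply: contrapT => /ukN H; rewrite H eqxx in uz.
  have wz : uk z = w z.
    rewrite ukE// max_r//; rewrite leNgt; apply/negP => /ltW H.
    by rewrite ukE// max_l// eqxx in uz.
  have [Zz _] := Er _ (EE _ Ez).
  rewrite wz; apply/ltW; apply: (@touched_bump_lt0 _ _ _ T F phi psi that xhat a) => //.
  + exact: cyl_time.
  + by case: Ez.
  + apply: filterS2 (near_ukE _ Ez) above => y yE.
    by apply: le_trans; rewrite yE le_max lexx orbT.
  + by rewrite -psiz wz.
  + exact: (ZW (z, (gam, del))).
- by move=> z _.
(* Three errors of [del / 4] arise: in the approximation of the envelope by [u], in the continuity
   of [phi], and in [gam * Q]. The bump then exceeds [u] by more than [del / 4]. *)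
- have d4 : 0 < del / 4 by rewrite divr_gt0.
  have n1 : \forall z \near (that, xhat), phi (that, xhat) - del / 4 < phi z.
    by apply: (cvgr_gt _ (C12_cvg phiC (x := xhat) that0T)); rewrite ltrBlDr ltrDl.
  have n2 : \forall z \near (that, xhat), bump_set that xhat a (eta / 4) z.
    apply: (@near_bump_set_lt _ _ _ _ _ _ 0); first by rewrite divr_gt0.
    by split=> //; rewrite /bump_dist /= subrr expr0n /= add0r sqdist0.
  have [z [cz [z1 [az z2]] uz]] := lsc_env_approx envE d4 (filterI n1 n2).
  apply: (@lt_le_trans _ _ (uk z - u z)%:E); last first.
    by apply: ereal_sup_ubound; exists z.
  have ee : eta / 4 <= eta by rewrite ler_pdivrMr// ler_pMr// ler1n.
  have Ez : E z by split=> //; exact: le_trans ee.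
  rewrite lte_fin subr_gt0 ukE// lt_max; apply/orP; right.
  have gQ : gam * bump_dist that xhat a z <= del / 4.
    by rewrite /del -mulrA ler_pM2l.
  rewrite /w /bump; move: uz z1 gQ del0.
  move: (gam * _) (phi _) (phi _) (u z) => *; lra.
- move=> z cz kz; apply: ukN => Ez.
  by have [_ [+ _]] := Er _ (EE _ Ez); rewrite ltNge kz.
Qed.
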